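(* Let $(L^+,L^-)$ be a pair of fully transverse prelaminations of $S^1$. Given any homeomorphism $f$ of $S^1$, there exists a homeomorphism $F$ of $\mathbb D^2$ sending geodesics of $\mathrm{Geo}(L^\pm)$ to geodesics of $\mathrm{Geo}(f(L^\pm))$ and restricting to $f$ on $S^1$.
   Context: $\mathbb D^2$ is the closed unit disc in $\mathbb R^2$ with boundary $S^1$. Pairs $\{a_1,a_2\},\{b_1,b_2\}$ of distinct points of $S^1$ cross if $a_1,a_2$ lie in different components of $S^1\setminus\{b_1,b_2\}$. A prelamination is a set of unordered pairs of distinct points of $S^1$ (leaves) no two of which cross. $\mathrm{Geo}(L)$ is the set of Euclidean straight chords in $\mathbb D^2$ whose pair of endpoints is a leaf of $L$. $(L^+,L^-)$ is fully transverse if $L^+\cap L^-=\emptyset$, the set of endpoints of leaves of $L^+\cup L^-$ is dense in $S^1$, and for any $\alpha,\beta\in L^+\cup L^-$ there is a sequence $\alpha=\alpha_1,\dots,\alpha_k=\beta$ of leaves with $\alpha_i$ crossing $\alpha_{i+1}$. $f(L^\pm)=\{\{f(a),f(a')\}:\{a,a'\}\in L^\pm\}$. *)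

(* Defs.v *)
From HB Require Import structures.
From mathcomp Require Import all_boot all_order all_algebra.
From mathcomp Require Import all_classical all_reals all_analysis.
Set Implicit Arguments. Unset Strict Implicit. Unset Printing Implicit Defensive.
Import Order.TTheory GRing.Theory Num.Theory numFieldNormedType.Exports.
Local Open Scope classical_set_scope.
Local Open Scope ring_scope.

Section Defs.
Variable R : realType.
Notation pt := (R * R)%type.

Definition S1 : set pt := [set p | p.1 ^+ 2 + p.2 ^+ 2 = 1].
Definition D2 : set pt := [set p | p.1 ^+ 2 + p.2 ^+ 2 <= 1].

Definition is_pair (l : set pt) :=
  exists a b, [/\ S1 a, S1 b, a != b & l = [set a; b]].

Definition cross (l m : set pt) :=
  exists a1 a2, [/\ l = [set a1; a2], (S1 `\` m) a1, (S1 `\` m) a2 &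
    ~ connected_component (S1 `\` m) a1 a2].

Definition prelamination (L : set (set pt)) :=
  (forall l, L l -> is_pair l) /\
  (forall l m, L l -> L m -> ~ cross l m).

Definition endpoints (L : set (set pt)) : set pt := \bigcup_(l in L) l.

Inductive cross_chain (L : set (set pt)) : set pt -> set pt -> Prop :=
| chain_refl a : L a -> cross_chain L a a
| chain_step a b c : L a -> cross a b -> cross_chain L b c -> cross_chain L a c.

Definition fully_transverse (Lp Lm : set (set pt)) :=
  [/\ prelamination Lp, prelamination Lm,
      Lp `&` Lm = set0,
      S1 `<=` closure (endpoints (Lp `|` Lm)) &
      (forall a b, (Lp `|` Lm) a -> (Lp `|` Lm) b -> cross_chain (Lp `|` Lm) a b)].

Definition chord (l : set pt) : set pt :=
  [set p | exists a b t, [/\ l = [set a; b], 0 <= t <= 1 &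
     p = ((1 - t) * a.1 + t * b.1, (1 - t) * a.2 + t * b.2)]].

Definition Geo (L : set (set pt)) : set (set pt) := chord @` L.

Definition image_lam (f : pt -> pt) (L : set (set pt)) : set (set pt) :=
  (fun l => f @` l) @` L.

Definition homeo_on (A : set pt) (F : pt -> pt) :=
  exists G : pt -> pt,
    [/\ (forall x, A x -> A (F x)), (forall x, A x -> A (G x)),
        (forall x, A x -> G (F x) = x), (forall x, A x -> F (G x) = x)
      & {within A, continuous F} /\ {within A, continuous G}].

End Defs.

(* Main.v *)
Require Import Defs.
From mathcomp Require Import all_boot all_order all_algebra.
From mathcomp Require Import all_classical all_reals all_analysis.
From mathcomp Require Import ring lra.
Set Implicit Arguments. Unset Strict Implicit. Unset Printing Implicit Defensive.
Import Order.TTheory GRing.Theory Num.Theory numFieldNormedType.Exports.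
Local Open Scope classical_set_scope.
Local Open Scope ring_scope.

(**
Close up both laminations: limits of leaves still do not cross leaves of the
same sign, and every pair of distinct points of the circle is crossed by some
leaf, because a chain of crossing leaves joins the two sides of a chord that no
leaf crosses. Hence a maximal region that no leaf cuts touches the circle in at
most one point.

The graph of [F] is built by increasing dimension. The set [G0] pairs a point of
the circle with its image, and the crossing point of a + leaf and a - leaf with
the crossing point of the image leaves. [G1] extends this affinely along each
leaf between consecutive points of [G0]. In a complementary region one picks one
vertex (the same combinatorial one in the domain and in the codomain) and cones
from it over the boundary: this is [G2]. Everything is symmetric in domain and
codomain, so it is enough that [G2] is closed, functional and total. For
closedness, a limit of such cones at a point which lies on a leaf degenerates
into a segment of that leaf, where the correspondence is affine anyway.
*)

(** * Continuity and compactness in the plane *)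

Section Topology.

(** The obstacle is that leaves may accumulate, so the complementary regions form no locally finite
    pattern. Regions are therefore never handled as objects: [compat] (no leaf strictly separates
    two points) stands in for lying in a common closed region, and the pattern of sides [sigma]
    names the region of a point off the leaves. All arguments reduce to signs of [det]. Signs at
    circle points are what a homeomorphism of the circle controls; signs inside the disc follow from
    them by convexity, whatever the weights. Domain and codomain are two instances of one structure
    over shared index types, so each lemma serves both.

    Working with a graph avoids estimates where cells shrink: compactness alone yields continuity.
    Compactness enters through the set of leaves paired with their images, which encodes at once the
    closing up of the laminations and the continuity of [f]. Uniqueness rests on one fact: a vertex
    is never strictly inside a segment between compatible points. *)

Lemma continuous_pair (T U V : topologicalType) (f : T -> U) (g : T -> V) :
  continuous f -> continuous g -> continuous (fun x => (f x, g x)).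
Proof. by move=> cf cg x; apply: cvg_pair; [exact: cf|exact: cg]. Qed.

Lemma continuous_fst (T U V : topologicalType) (f : T -> U * V) :
  continuous f -> continuous (fun x => (f x).1).
Proof. by move=> cf x; apply: continuous_comp; [exact: cf|exact: cvg_fst]. Qed.

Lemma continuous_snd (T U V : topologicalType) (f : T -> U * V) :
  continuous f -> continuous (fun x => (f x).2).
Proof. by move=> cf x; apply: continuous_comp; [exact: cf|exact: cvg_snd]. Qed.

Variables (R : realType) (T : topologicalType).
Implicit Types f g : T -> R.

Lemma continuous_add f g :
  continuous f -> continuous g -> continuous (fun x => f x + g x).
Proof. by move=> cf cg x; apply: (@continuousD _ R^o); [exact: cf|exact: cg]. Qed.

Lemma continuous_opp f : continuous f -> continuous (fun x => - f x).
Proof. by move=> cf x; apply: (@continuousN _ R^o); exact: cf. Qed.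

Lemma continuous_mul f g :
  continuous f -> continuous g -> continuous (fun x => f x * g x).
Proof. by move=> cf cg x; apply: continuousM; [exact: cf|exact: cg]. Qed.

Lemma continuous_inv f : (forall x, f x != 0) ->
  continuous f -> continuous (fun x => (f x)^-1).
Proof. by move=> n cf x; exact: (@continuousV _ _ f x (n x) (cf x)). Qed.

Lemma continuous_sqr f : continuous f -> continuous (fun x => f x ^+ 2).
Proof. exact: (fun cf => continuous_mul cf cf). Qed.

Lemma continuous_const (U : topologicalType) (a : U) : continuous (fun _ : T => a).
Proof. by move=> x; exact: cvg_cst. Qed.

Lemma continuous_id : continuous (fun x : T => x).
Proof. by move=> x; exact: cvg_id. Qed.

Lemma closed_preimage (U : topologicalType) (f : T -> U) (A : set U) :
  continuous f -> closed A -> closed (f @^-1` A).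
Proof. by move=> cf cA; apply: preimage_closed => // x _; exact: cf. Qed.

Lemma closed_ge0 f : continuous f -> closed [set x | 0 <= f x].
Proof. by move=> cf; exact: (closed_preimage (A := [set y : R | 0 <= y]) cf (@closed_ge _ 0)). Qed.

Lemma closed_eq0 f : continuous f -> closed [set x | f x = 0].
Proof. by move=> cf; exact: (closed_preimage (A := [set y : R | y = 0]) cf (@closed_eq _ 0)). Qed.

Lemma open_gt0 f : continuous f -> open [set x | 0 < f x].
Proof. by move/continuousP => /(_ [set y : R | 0 < y]); apply; exact: open_gt. Qed.

End Topology.

Ltac cts := lazymatch goal with
  | |- forall x, continuous_at x (fun y => y) => exact: continuous_id
  | |- forall x, continuous_at x (fun y => (@?f y, @?g y)) =>
      apply: (@continuous_pair _ _ _ f g); cts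
  | |- forall x, continuous_at x (fun y => fst (@?f y)) =>
      apply: (@continuous_fst _ _ _ f); cts
  | |- forall x, continuous_at x (fun y => snd (@?f y)) =>
      apply: (@continuous_snd _ _ _ f); cts
  | |- forall x, continuous_at x (fun y => @?f y ^+ 2) =>
      apply: (@continuous_sqr _ _ f); cts
  | |- forall x, continuous_at x (fun y => @?f y + @?g y) =>
      apply: (@continuous_add _ _ f g); cts
  | |- forall x, continuous_at x (fun y => - @?f y) =>
      apply: (@continuous_opp _ _ f); cts
  | |- forall x, continuous_at x (fun y => @?f y * @?g y) =>
      apply: (@continuous_mul _ _ f g); cts
  | |- _ => exact: continuous_const
  end.

Section PlaneTopology.
Variable R : realType.
Notation pt := (R * R)%type.

Lemma plane_hausdorff : hausdorff_space pt.
Proof. exact: norm_hausdorff. Qed.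

Lemma closed_D2 : closed (@D2 R).
Proof.
have -> : @D2 R = [set p | 0 <= 1 - (p.1 ^+ 2 + p.2 ^+ 2)].
  by apply/seteqP; split=> p /=; rewrite /D2 /= subr_ge0.
by apply: closed_ge0; cts.
Qed.

Lemma compact_D2 : compact (@D2 R).
Proof.
apply: (subclosed_compact closed_D2
  (compact_setX (segment_compact (a := -1 : R) (b := 1)) (segment_compact (a := -1 : R) (b := 1)))).
move=> p; rewrite /D2 /= => h; rewrite !in_itv /=.
have := sqr_ge0 p.1; have := sqr_ge0 p.2 => h1 h2.
by split; apply/andP; split; nra.
Qed.

Lemma compact_S1 : compact (@S1 R).
Proof.
apply: (subclosed_compact _ compact_D2); last by move=> p; rewrite /S1 /D2 /= => ->.
have -> : @S1 R = [set p | p.1 ^+ 2 + p.2 ^+ 2 - 1 = 0].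
  by apply/seteqP; split=> p /=; rewrite /S1 /= => /eqP; [|rewrite subr_eq0];
    [rewrite -subr_eq0 => /eqP|move/eqP].
by apply: closed_eq0; cts.
Qed.

End PlaneTopology.

(** * Chords of the unit circle *)

Section PlaneGeometry.
Variable R : realType.
Notation pt := (R * R)%type.
Implicit Types (a b c d p q r : pt) (t : R).

(** Twice the signed area of the triangle [a], [b], [p]; the sign is the side of the line through
    [a] and [b]. *)
Definition det a b p : R :=
  (b.1 - a.1) * (p.2 - a.2) - (b.2 - a.2) * (p.1 - a.1).

Definition cv t p q : pt :=
  ((1 - t) * p.1 + t * q.1, (1 - t) * p.2 + t * q.2).

Definition nsq p : R := p.1 ^+ 2 + p.2 ^+ 2.

Definition dsq p q : R := (p.1 - q.1) ^+ 2 + (p.2 - q.2) ^+ 2.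

Lemma ptP p q : p.1 = q.1 -> p.2 = q.2 -> p = q.
Proof. by case: p q => ? ? [? ?] /= -> ->. Qed.

Lemma dsq_ge0 p q : 0 <= dsq p q.
Proof. by rewrite addr_ge0 ?sqr_ge0. Qed.

Lemma dsq_eq0 p q : dsq p q = 0 -> p = q.
Proof.
move/eqP; rewrite paddr_eq0 ?sqr_ge0 // !sqrf_eq0 !subr_eq0 => /andP[/eqP e1 /eqP e2].
exact: ptP.
Qed.

Lemma dsq_gt0 p q : p <> q -> 0 < dsq p q.
Proof. by rewrite lt0r dsq_ge0 andbT => h; apply/eqP => /dsq_eq0. Qed.

Lemma S1_D2 p : S1 p -> D2 p.
Proof. by rewrite /S1 /D2 /= => ->. Qed.

Lemma det_cv a b t p q : det a b (cv t p q) = (1 - t) * det a b p + t * det a b q.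
Proof. rewrite /det /cv /=; ring. Qed.

Lemma cv0 p q : cv 0 p q = p.
Proof. by apply: ptP; rewrite /cv /=; ring. Qed.

Lemma cv1 p q : cv 1 p q = q.
Proof. by apply: ptP; rewrite /cv /=; ring. Qed.

Lemma cvC t p q : cv t p q = cv (1 - t) q p.
Proof. by apply: ptP; rewrite /cv /=; ring. Qed.

Lemma cvpp t p : cv t p p = p.
Proof. by apply: ptP; rewrite /cv /=; ring. Qed.

(** Stewart's identity; its last term makes the disc strictly convex. *)
Lemma nsq_cv t p q :
  nsq (cv t p q) = (1 - t) * nsq p + t * nsq q - t * (1 - t) * dsq p q.
Proof. rewrite /nsq /dsq /cv /=; ring. Qed.

Lemma cv_inj t s p q : p <> q -> cv t p q = cv s p q -> t = s.
Proof.
move=> /dsq_gt0 pq e; have: (t - s) * dsq p q = 0.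
  have e1 : (cv t p q).1 = (cv s p q).1 by rewrite e.
  have e2 : (cv t p q).2 = (cv s p q).2 by rewrite e.
  move: e1 e2; rewrite /cv /dsq /= => e1 e2.
  have -> : (t - s) * ((p.1 - q.1) ^+ 2 + (p.2 - q.2) ^+ 2) =
    - (p.1 - q.1) * (((1 - t) * p.1 + t * q.1) - ((1 - s) * p.1 + s * q.1))
    - (p.2 - q.2) * (((1 - t) * p.2 + t * q.2) - ((1 - s) * p.2 + s * q.2)) by ring.
  by rewrite e1 e2 !subrr !mulr0 subrr.
move/eqP; rewrite mulf_eq0 => /orP[/eqP/subr0_eq//|/eqP h].
by rewrite h ltxx in pq.
Qed.

Lemma D2_cv t p q : 0 <= t <= 1 -> D2 p -> D2 q -> D2 (cv t p q).
Proof.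
move=> /andP[t0 t1]; rewrite /D2 /= -/(nsq p) -/(nsq q) -/(nsq (cv t p q)) => hp hq.
rewrite nsq_cv; have := dsq_ge0 p q => d0.
have h1 : (1 - t) * nsq p <= (1 - t) * 1 by apply: ler_wpM2l; lra.
have h2 : t * nsq q <= t * 1 by apply: ler_wpM2l.
have h3 : 0 <= t * (1 - t) * dsq p q by rewrite !mulr_ge0 //; lra.
lra.
Qed.

Lemma S1_cv t p q : 0 < t < 1 -> D2 p -> D2 q -> S1 (cv t p q) -> p = q.
Proof.
move=> /andP[t0 t1]; rewrite /D2 /S1 /= -/(nsq p) -/(nsq q) -/(nsq (cv t p q)) => hp hq.
rewrite nsq_cv => e; apply: dsq_eq0; apply/eqP; rewrite eq_le dsq_ge0 andbT.
have h1 : (1 - t) * nsq p <= (1 - t) * 1 by apply: ler_wpM2l; lra.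
have h2 : t * nsq q <= t * 1 by apply: ler_wpM2l => //; lra.
have h4 : 0 < t * (1 - t) by rewrite mulr_gt0 //; lra.
rewrite -(pmulr_rle0 _ h4); lra.
Qed.

Lemma line_param q r p : q <> r -> det q r p = 0 -> exists t, p = cv t q r.
Proof.
move=> qr dp; have n0 := dsq_gt0 qr.
have n0' : dsq q r != 0 by rewrite gt_eqF.
(* The parameter of the orthogonal projection of [p] onto the line; [p] is its own projection
   because [det] vanishes. *)
exists (((p.1 - q.1) * (r.1 - q.1) + (p.2 - q.2) * (r.2 - q.2)) / dsq q r).
move: dp n0'; rewrite /det => dp n0'.
have e1 : (p.1 - q.1) * dsq q r =
   ((p.1 - q.1) * (r.1 - q.1) + (p.2 - q.2) * (r.2 - q.2)) * (r.1 - q.1).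
  rewrite /dsq; apply: subr0_eq.
  transitivity (- (r.2 - q.2) * ((r.1 - q.1) * (p.2 - q.2) - (r.2 - q.2) * (p.1 - q.1))).
    ring.
  by rewrite dp mulr0.
have e2 : (p.2 - q.2) * dsq q r =
   ((p.1 - q.1) * (r.1 - q.1) + (p.2 - q.2) * (r.2 - q.2)) * (r.2 - q.2).
  rewrite /dsq; apply: subr0_eq.
  transitivity ((r.1 - q.1) * ((r.1 - q.1) * (p.2 - q.2) - (r.2 - q.2) * (p.1 - q.1))).
    ring.
  by rewrite dp mulr0.
apply: ptP; rewrite /cv /=.
  apply: (mulIf n0'); transitivity (q.1 * dsq q r + (p.1 - q.1) * dsq q r); first ring.
  by rewrite e1; field.
apply: (mulIf n0'); transitivity (q.2 * dsq q r + (p.2 - q.2) * dsq q r); first ring.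
by rewrite e2; field.
Qed.

Lemma det_cvl a b : det a b a = 0. Proof. rewrite /det; ring. Qed.
Lemma det_cvr a b : det a b b = 0. Proof. rewrite /det; ring. Qed.

Lemma det0_cv a b t : det a b (cv t a b) = 0.
Proof. by rewrite det_cv det_cvl det_cvr !mulr0 addr0. Qed.

Lemma same_line a b c d q r : c <> d -> q <> r ->
  det a b q = 0 -> det a b r = 0 -> det c d q = 0 -> det c d r = 0 ->
  forall t, det a b (cv t c d) = 0.
Proof.
move=> cd qr abq abr cdq cdr t.
have [s1 e1] := line_param cd cdq.
have [s2 e2] := line_param cd cdr.
have h s : det q r (cv s c d) = 0 by rewrite e1 e2 /det /cv /=; ring.
have [s ->] := line_param qr (h t).
by rewrite det_cv abq abr !mulr0 addr0.
Qed.

Lemma chord_param a b p : S1 a -> S1 b -> a <> b -> D2 p -> det a b p = 0 ->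
  exists2 t, 0 <= t <= 1 & p = cv t a b.
Proof.
move=> Sa Sb ab Dp /(line_param ab)[t e]; exists t => //.
move: Dp; rewrite e /D2 /= -/(nsq (cv t a b)) nsq_cv /nsq.
rewrite [a.1 ^+ 2 + _]Sa [b.1 ^+ 2 + _]Sb => h.
have h1 : 0 <= t * (1 - t).
  by rewrite -(pmulr_lge0 _ (dsq_gt0 ab)); lra.
apply/andP; split; nra.
Qed.

Lemma chord_param_lt a b p : S1 a -> S1 b -> a <> b -> D2 p -> ~ S1 p ->
  det a b p = 0 -> exists2 t, 0 < t < 1 & p = cv t a b.
Proof.
move=> Sa Sb ab Dp nSp dp; have [t /andP[t0 t1] e] := chord_param Sa Sb ab Dp dp.
exists t => //; rewrite !lt_neqAle t0 t1 !andbT.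
apply/andP; split; apply/eqP => h; apply: nSp; rewrite e.
  by rewrite -h cv0.
by rewrite h cv1.
Qed.

Lemma S1_det0 a b c : S1 a -> S1 b -> a <> b -> S1 c -> det a b c = 0 ->
  c = a \/ c = b.
Proof.
move=> Sa Sb ab Sc dc.
have [t /andP[t0 t1] e] := chord_param Sa Sb ab (S1_D2 Sc) dc.
have [t0'|t0'] := eqVneq t 0; first by left; rewrite e t0' cv0.
have [t1'|t1'] := eqVneq t 1; first by right; rewrite e t1' cv1.
exfalso; apply: ab; apply: (@S1_cv t); rewrite -?e ?[D2 _]S1_D2 //; try exact: S1_D2.
by rewrite !lt_neqAle t0 t1 t1' eq_sym t0'.
Qed.

Lemma sign_change_cv (g h : R) : g * h < 0 ->
  exists2 t, 0 < t < 1 & (1 - t) * g + t * h = 0.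
Proof.
move=> gh; have gh0 : g - h != 0 by apply/eqP => e; nra.
exists (g / (g - h)); last by field.
have h1 : (g / (g - h)) * (1 - g / (g - h)) * (g - h) ^+ 2 = - (g * h) by field.
have h2 : 0 < (g - h) ^+ 2 by rewrite exprn_even_gt0.
have h3 : 0 < (g / (g - h)) * (1 - g / (g - h)).
  by rewrite -(pmulr_lgt0 _ h2) h1 oppr_gt0.
apply/andP; split; nra.
Qed.

(** The chord [cd] meets the line [ab] at an interior point of the disc, hence strictly between [a]
    and [b]. There [det c d] is a combination of its values at [a] and [b] with positive weights,
    and it vanishes. *)
Lemma cross_sym a b c d : S1 a -> S1 b -> a <> b -> S1 c -> S1 d -> c <> d ->
  det a b c * det a b d < 0 -> det c d a * det c d b < 0.
Proof.
move=> Sa Sb ab Sc Sd cd h.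
have [t t01 e] := sign_change_cv h.
have pe : det a b (cv t c d) = 0 by rewrite det_cv.
have Dp : D2 (cv t c d).
  by apply: D2_cv; [lra | exact: S1_D2 | exact: S1_D2].
have nSp : ~ S1 (cv t c d).
  by move/S1_cv => /(_ t01 (S1_D2 Sc) (S1_D2 Sd)).
have [s s01 es] := chord_param_lt Sa Sb ab Dp nSp pe.
have := det0_cv c d t; rewrite es det_cv => e'.
have na : det c d a <> 0.
  move=> /(S1_det0 Sc Sd cd Sa)[] ea; move: h; rewrite ea ?det_cvl ?det_cvr ?mul0r ?mulr0 ltxx //.
case/andP: s01 => s0 s1.
have hs : 0 < (1 - s) by lra.
have : det c d a * det c d b * s = - (1 - s) * det c d a ^+ 2.
  have -> : det c d a * det c d b * s = det c d a * (s * det c d b) by ring.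
  have -> : s * det c d b = - (1 - s) * det c d a by lra.
  by ring.
have : 0 < det c d a ^+ 2 by rewrite exprn_even_gt0 //=; apply/eqP.
nra.
Qed.

(** When no cancellation can occur, the sign of a convex combination does not see the weights. Hence
    the positions of corresponding points on a leaf and on its image may differ freely. *)
Lemma sg_conv (t t' a b a' b' : R) : 0 < t < 1 -> 0 < t' < 1 ->
  0 <= a * b -> Num.sg a = Num.sg a' -> Num.sg b = Num.sg b' ->
  Num.sg ((1 - t) * a + t * b) = Num.sg ((1 - t') * a' + t' * b').
Proof.
move=> /andP[t0 t1] /andP[s0 s1].
have t2 : 0 < 1 - t by lra.
have s2 : 0 < 1 - t' by lra.
have sgsum (x y : R) : 0 <= x * y -> Num.sg (x + y) = if x == 0 then Num.sg y else Num.sg x.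
  have [->|x0 h] := eqVneq x 0; first by rewrite add0r.
  have [xp|xn|e] := ltgtP 0 x; last by rewrite -e eqxx in x0.
    by rewrite !gtr0_sg //; nra.
  by rewrite !ltr0_sg //; nra.
move=> ab ea eb.
have ab' : 0 <= a' * b' by rewrite -sgr_ge0 sgrM -ea -eb -sgrM sgr_ge0.
rewrite !sgsum.
- by rewrite !mulf_eq0 (gt_eqF t2) (gt_eqF s2)
    /= !sgrM (gtr0_sg t0) (gtr0_sg s0) (gtr0_sg t2) (gtr0_sg s2) !mul1r
    -(sgr_eq0 a) -(sgr_eq0 a') ea eb.
- by rewrite mulrACA mulr_ge0 // ltW // mulr_gt0.
by rewrite mulrACA mulr_ge0 // ltW // mulr_gt0.
Qed.

End PlaneGeometry.

(** * Families of leaves and the correspondence *)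

Section Model.
Variables (R : realType) (I J : Type) (u v : I -> J) (k : I -> bool).
Notation pt := (R * R)%type.

(* Leaf [i] joins the circle points indexed by [u i] and [v i], which lie at
   [x (u i)] and [x (v i)]; the sign of [lf x s i p] is the side of [p]. *)
Definition lf (x : J -> pt) (s : I -> R) i p : R :=
  s i * det (x (u i)) (x (v i)) p.

(** The factor [s] leaves the orientation of each leaf free. The weak inequality of [model_noncross]
    admits shared endpoints and repeated leaves. *)
Record model (x : J -> pt) (s : I -> R) : Prop := Model {
  model_S1 : forall j, S1 (x j);
  model_inj : forall j j', x j = x j' -> j = j';
  model_surj : forall p, S1 p -> exists j, x j = p;
  model_unit : forall i, s i != 0;
  model_uv : forall i, u i <> v i;
  model_noncross : forall i m, k i = k m ->
    0 <= lf x s m (x (u i)) * lf x s m (x (v i));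
  model_cross : forall j j', j <> j' ->
    exists i, lf x s i (x j) * lf x s i (x j') < 0 }.

Section OneModel.
Variables (x : J -> pt) (s : I -> R).
Hypothesis M : model x s.
Notation l := (lf x s).

Definition compat p q := forall i, 0 <= l i p * l i q.

Definition onK p := S1 p \/ exists i, l i p = 0.

(** The vertices, as [onK] gives the edges; both are applied to points of the disc, where the line
    of a leaf is its chord. *)
Definition onE p :=
  S1 p \/ exists i m, [/\ k i = true, k m = false, l i p = 0 & l m p = 0].

Lemma lf_cv i t p q : l i (cv t p q) = (1 - t) * l i p + t * l i q.
Proof. by rewrite /lf det_cv; ring. Qed.

Lemma lf_u i : l i (x (u i)) = 0. Proof. by rewrite /lf det_cvl mulr0. Qed.
Lemma lf_v i : l i (x (v i)) = 0. Proof. by rewrite /lf det_cvr mulr0. Qed.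

Lemma lf_det i p : l i p = 0 -> det (x (u i)) (x (v i)) p = 0.
Proof.
by move/eqP; rewrite mulf_eq0 (negPf (model_unit M i)) /= => /eqP.
Qed.

Lemma xuv i : x (u i) <> x (v i).
Proof. by move/(model_inj M); exact: model_uv M i. Qed.

Lemma lf_chord i p : D2 p -> l i p = 0 ->
  exists2 t, 0 <= t <= 1 & p = cv t (x (u i)) (x (v i)).
Proof.
move=> Dp /lf_det; apply: chord_param => //; [exact: model_S1 M _|exact: model_S1 M _|].
exact: xuv.
Qed.

Lemma lf_chord_lt i p : D2 p -> ~ S1 p -> l i p = 0 ->
  exists2 t, 0 < t < 1 & p = cv t (x (u i)) (x (v i)).
Proof.
move=> Dp nS /lf_det; apply: chord_param_lt => //; [exact: model_S1 M _|exact: model_S1 M _|].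
exact: xuv.
Qed.

Lemma lf_S1 i j : l i (x j) = 0 -> j = u i \/ j = v i.
Proof.
move/lf_det/(S1_det0 (model_S1 M _) (model_S1 M _) (@xuv i) (model_S1 M j)).
by case=> /(model_inj M) ->; [left|right].
Qed.

(** A leaf that separates the ends of [m] has the kind of [m] or of [i]. If [i] and [m] had the same
    ends, it would cross a leaf of its own kind. *)
Lemma kinds_distinct i m : k i <> k m ->
  l i (x (u m)) = 0 -> l i (x (v m)) = 0 -> False.
Proof.
move=> kim /lf_S1 hu /lf_S1 hv.
have [n hn] := model_cross M (model_uv M (i := m)).
have [e|e] : k m = k n \/ k i = k n.
  by case: (k m) (k i) (k n) kim => [] [] [] //; auto.
  by have := model_noncross M e; rewrite leNgt hn.
have := model_noncross M e; rewrite leNgt => /negP; apply.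
have uv := model_uv M (i := m).
by case: hu hv hn uv => -> [] -> //; rewrite mulrC.
Qed.

Lemma two_points_vanish i m p q : p <> q ->
  l i p = 0 -> l i q = 0 -> l m p = 0 -> l m q = 0 ->
  l i (x (u m)) = 0 /\ l i (x (v m)) = 0.
Proof.
move=> pq /lf_det ip /lf_det iq /lf_det mp /lf_det mq.
have h := same_line (@xuv m) pq ip iq mp mq.
have h0 := h 0; have h1 := h 1; rewrite cv0 in h0; rewrite cv1 in h1.
by rewrite /lf h0 h1 mulr0.
Qed.

Lemma kinds_meet_once i m p q : k i <> k m ->
  l i p = 0 -> l m p = 0 -> l i q = 0 -> l m q = 0 -> p = q.
Proof.
move=> kim ip mp iq mq; apply: contrapT => pq.
by have [] := two_points_vanish pq ip iq mp mq; exact: kinds_distinct.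
Qed.

Lemma lf_cv_eq0 i t p q : 0 < t < 1 -> 0 <= l i p * l i q ->
  l i (cv t p q) = 0 -> l i p = 0 /\ l i q = 0.
Proof.
case/andP=> t0 t1 pq; rewrite lf_cv => e.
have t2 : 0 < 1 - t by lra.
have h1 : (1 - t) * l i p ^+ 2 = - (t * (l i p * l i q)).
  transitivity (l i p * ((1 - t) * l i p + t * l i q) - t * (l i p * l i q)); first ring.
  by rewrite e mulr0 sub0r.
have h2 : 0 <= t * (l i p * l i q) by rewrite mulr_ge0 // ltW.
have h3 : l i p = 0.
  apply/eqP; rewrite -sqrf_eq0 eq_le sqr_ge0 andbT -(pmulr_rle0 _ t2) h1.
  by rewrite oppr_le0.
split=> //; move: e; rewrite h3 mulr0 add0r => /eqP.
by rewrite mulf_eq0 gt_eqF //= => /eqP.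
Qed.

(** A leaf through an inner point of a segment between compatible points contains both ends. A
    vertex lies on two leaves of different kinds, which share at most one point; on the circle,
    strict convexity replaces this. *)
Lemma extreme t p q : 0 < t < 1 -> D2 p -> D2 q -> compat p q ->
  onE (cv t p q) -> p = q.
Proof.
move=> t01 Dp Dq c [|[i [m [ki km /(lf_cv_eq0 t01 (c i))[ip iq] /(lf_cv_eq0 t01 (c m))[mp mq]]]]].
  exact: S1_cv.
by apply: (kinds_meet_once (i := i) (m := m)); rewrite // ki km.
Qed.

(** Inside the disc, two leaves of one kind that touch without crossing coincide. *)
Lemma same_leaf_ends i m p : k i = k m -> D2 p -> ~ S1 p ->
  l i p = 0 -> l m p = 0 -> l m (x (u i)) = 0 /\ l m (x (v i)) = 0.
Proof.
move=> kim Dp nS ip mp; have [t t01 e] := lf_chord_lt Dp nS ip.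
by apply: (lf_cv_eq0 t01); rewrite -?e //; exact: model_noncross M _ _ kim.
Qed.

Lemma ends_vanish i m q : D2 q -> l m (x (u i)) = 0 -> l m (x (v i)) = 0 ->
  l i q = 0 -> l m q = 0.
Proof.
by move=> Dq mu mv /(lf_chord Dq)[t _ ->]; rewrite lf_cv mu mv !mulr0 addr0.
Qed.

Lemma onE_onK p : onE p -> onK p.
Proof. by case=> [|[i [m [_ _ ip _]]]]; [left|right; exists i]. Qed.

Lemma compatC p q : compat p q -> compat q p.
Proof. by move=> c i; rewrite mulrC; exact: c. Qed.

End OneModel.

(* The leaves of one kind together with the images of their endpoints; degenerate
   leaves are included so that compactness can be required of this set. *)
Definition Lam (x x' : J -> pt) (b : bool) : set ((pt * pt) * (pt * pt)) :=
  [set z | (exists2 i, k i = b & z = ((x (u i), x' (u i)), (x (v i), x' (v i)))) \/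
           exists j, z = ((x j, x' j), (x j, x' j))].

(** Signs are compared at circle points only; [G0_agree] and [cvW_agree] carry the comparison into
    the disc. *)
Record dmodel (x x' : J -> pt) (s s' : I -> R) : Prop := DModel {
  dmodel_l : model x s;
  dmodel_r : model x' s';
  dmodel_sg : forall i j, Num.sg (lf x s i (x j)) = Num.sg (lf x' s' i (x' j));
  dmodel_compact : forall b, compact (Lam x x' b) }.

Definition cvW t (w z : pt * pt) : pt * pt := (cv t w.1 z.1, cv t w.2 z.2).

Definition sigma x s p : I -> bool := fun i => 0 < lf x s i p.

Section Correspondence.
Variables (x x' : J -> pt) (s s' : I -> R) (base : (I -> bool) -> pt * pt).

Definition G0 : set (pt * pt) := [set w | (exists j, w = (x j, x' j)) \/
  [/\ D2 w.1, D2 w.2 & exists i m, [/\ k i = true, k m = false,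
      lf x s i w.1 = 0 /\ lf x s m w.1 = 0 &
      lf x' s' i w.2 = 0 /\ lf x' s' m w.2 = 0]]].

Definition G1 : set (pt * pt) := [set w | exists t e g,
  [/\ 0 <= t <= 1, G0 e /\ G0 g, compat x s e.1 g.1, w = cvW t e g & onK x s w.1]].

(* [base] chooses, for the side pattern of a complementary region, its cone vertex
   and the image of that vertex. *)
Definition G2 : set (pt * pt) := [set w | exists t e b,
  [/\ 0 <= t <= 1, G0 e /\ G1 b, compat x s e.1 b.1, w = cvW t e b &
      onK x s w.1 \/ e = base (sigma x s w.1)]].

Definition agree w := forall i, Num.sg (lf x s i w.1) = Num.sg (lf x' s' i w.2).

End Correspondence.
End Model.

(** * Exchange of domain and codomain *)

Section Swap.
Variables (R : realType) (I J : Type) (u v : I -> J) (k : I -> bool).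
Notation pt := (R * R)%type.

Lemma dmodel_sym (x x' : J -> pt) (s s' : I -> R) :
  dmodel u v k x x' s s' -> dmodel u v k x' x s' s.
Proof.
move=> [M M' sg cp]; split=> // b.
have -> : Lam u v k x' x b = (fun z => (swap_pair z.1, swap_pair z.2)) @` Lam u v k x x' b.
  apply/seteqP; split=> z /=.
    case=> [[i ki ->]|[j ->]].
      by exists ((x (u i), x' (u i)), (x (v i), x' (v i))) => //; left; exists i.
    by exists ((x j, x' j), (x j, x' j)) => //; right; exists j.
  move=> [_ [[i ki ->]|[j ->]] <-]; first by left; exists i.
  by right; exists j.
apply: continuous_compact (cp b); apply: continuous_subspaceT.
by rewrite /swap_pair; cts.
Qed.

End Swap.

(** * Corresponding points lie on corresponding sides *)

Section Functional.
Variables (R : realType) (I J : Type) (u v : I -> J) (k : I -> bool).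
Notation pt := (R * R)%type.

Lemma sg_eq0 (a b : R) : Num.sg a = Num.sg b -> a = 0 -> b = 0.
Proof. by move=> e a0; apply/eqP; rewrite -sgr_eq0 -e a0 sgr0. Qed.

Lemma sg_le0 (a b a' b' : R) : Num.sg a = Num.sg a' -> Num.sg b = Num.sg b' ->
  0 <= a * b -> 0 <= a' * b'.
Proof. by move=> e1 e2; rewrite -sgr_ge0 sgrM e1 e2 -sgrM sgr_ge0. Qed.

Lemma G0_D2 (x x' : J -> pt) (s s' : I -> R) w : dmodel u v k x x' s s' ->
  G0 u v k x x' s s' w -> D2 w.1 /\ D2 w.2.
Proof.
move=> D [[j ->]|[]//]; split; apply: S1_D2.
  exact: model_S1 (dmodel_l D) j.
exact: model_S1 (dmodel_r D) j.
Qed.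

Lemma G0_sym (x x' : J -> pt) (s s' : I -> R) w :
  G0 u v k x x' s s' w -> G0 u v k x' x s' s (swap_pair w).
Proof.
case=> [[j ->]|[D1 D2w [i [m [ki km h h']]]]]; first by left; exists j.
by right; split=> //; exists i, m.
Qed.

(** Leaves of different kinds may share an end [j]. Their images then share [x' j], and meet nowhere
    else, so both clauses of [G0] give the same pair. *)
Lemma G0_S1l (x x' : J -> pt) (s s' : I -> R) w : dmodel u v k x x' s s' ->
  G0 u v k x x' s s' w -> S1 w.1 -> exists j, w = (x j, x' j).
Proof.
move=> D [//|[D1 D2w [i [m [ki km [i1 m1] [i2 m2]]]]]] /(model_surj (dmodel_l D))[j e].
exists j; rewrite [w]surjective_pairing -e; congr pair.
have kim : k i <> k m by rewrite ki km.
apply: (kinds_meet_once (dmodel_r D) kim) => //.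
  by apply: sg_eq0 (dmodel_sg D i j) _; rewrite e.
by apply: sg_eq0 (dmodel_sg D m j) _; rewrite e.
Qed.

Lemma G0_S1r (x x' : J -> pt) (s s' : I -> R) w : dmodel u v k x x' s s' ->
  G0 u v k x x' s s' w -> S1 w.2 -> exists j, w = (x j, x' j).
Proof.
move=> D /G0_sym g S; have [j] := G0_S1l (dmodel_sym D) g S.
by case: w {g S} => a b [-> ->]; exists j.
Qed.

Variables (x x' : J -> pt) (s s' : I -> R) (base : (I -> bool) -> pt * pt).
Hypothesis D : dmodel u v k x x' s s'.
Let M := dmodel_l D.
Let M' := dmodel_r D.
Notation l := (lf u v x s).
Notation l' := (lf u v x' s').
Notation G0 := (G0 u v k x x' s s').
Notation G1 := (G1 u v k x x' s s').
Notation G2 := (G2 u v k x x' s s' base).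
Notation agree := (agree u v x x' s s').
Notation compat := (compat u v x s).
Notation onE := (onE u v k x s).
Notation onK := (onK u v x s).

Lemma G0_onE w : G0 w -> onE w.1.
Proof.
case=> [[j ->]|[_ _ [i [m [ki km [i1 m1] _]]]]]; first by left; exact: model_S1 M j.
by right; exists i, m.
Qed.

(** Of the two leaves through a crossing point, one has the kind of [n]. It stays on one side of
    [n], so the sign of [n] along its interior is determined by the signs at its ends. *)
Lemma G0_agree w : G0 w -> agree w.
Proof.
move=> g n.
have [/(G0_S1l D g)[j ->]|nS] := pselect (S1 w.1); first exact: dmodel_sg D n j.
have nS' : ~ S1 w.2.
  by move=> /(G0_S1r D g)[j e]; apply: nS; rewrite e; exact: model_S1 M j.
case: g => [[j e]|[D1 D2w [i [m [ki km [i1 m1] [i2 m2]]]]]].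
  by case: nS; rewrite e; exact: model_S1 M j.
have claim a : k a = k n -> l a w.1 = 0 -> l' a w.2 = 0 ->
    Num.sg (l n w.1) = Num.sg (l' n w.2).
  move=> ka a1 a2; have [t t01 ->] := lf_chord_lt M D1 nS a1.
  have [t' t01' ->] := lf_chord_lt M' D2w nS' a2.
  rewrite !lf_cv; apply: sg_conv => //; first exact: model_noncross M _ _ ka.
    exact: dmodel_sg D _ _.
  exact: dmodel_sg D _ _.
case kn: (k n); first by apply: (claim i) => //; rewrite ki kn.
by apply: (claim m) => //; rewrite km kn.
Qed.

Lemma cvW_agree t w z : 0 <= t <= 1 -> agree w -> agree z -> compat w.1 z.1 ->
  agree (cvW t w z).
Proof.
move=> /andP[t0 t1] aw az c n; rewrite /cvW /=.
have [->|tn0] := eqVneq t 0; first by rewrite !cv0.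
have [->|tn1] := eqVneq t 1; first by rewrite !cv1.
have t01 : 0 < t < 1 by rewrite !lt_neqAle t0 t1 tn1 eq_sym tn0.
by rewrite !lf_cv; apply: sg_conv.
Qed.

Lemma G1_agree w : G1 w -> agree w.
Proof.
by move=> [t [e [g [t01 [Ge Gg] c -> _]]]]; apply: cvW_agree => //; exact: G0_agree.
Qed.

Lemma G2_agree w : G2 w -> agree w.
Proof.
move=> [t [e [g [t01 [Ge Gg] c -> _]]]]; apply: cvW_agree => //; first exact: G0_agree.
exact: G1_agree.
Qed.

Lemma agree_compat w z : agree w -> agree z -> compat w.1 z.1 ->
  forall i, 0 <= l' i w.2 * l' i z.2.
Proof. by move=> aw az c i; exact: sg_le0 (aw i) (az i) (c i). Qed.

End Functional.

(** * The correspondence is functional *)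

Section Uniqueness.
Variables (R : realType) (I J : Type) (u v : I -> J) (k : I -> bool).
Notation pt := (R * R)%type.

Lemma cvW0 (w z : pt * pt) : cvW 0 w z = w.
Proof. by rewrite /cvW !cv0 -surjective_pairing. Qed.

Lemma cvW1 (w z : pt * pt) : cvW 1 w z = z.
Proof. by rewrite /cvW !cv1 -surjective_pairing. Qed.

Lemma cvWpp t (w : pt * pt) : cvW t w w = w.
Proof. by rewrite /cvW !cvpp -surjective_pairing. Qed.

Lemma cvWC t (w z : pt * pt) : cvW t w z = cvW (1 - t) z w.
Proof. by rewrite /cvW; congr pair; exact: cvC. Qed.

Lemma cv_cv t (p q : pt) a b : cv t (cv a p q) (cv b p q) = cv ((1 - t) * a + t * b) p q.
Proof. by apply: ptP; rewrite /cv /=; ring. Qed.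

Lemma unit_cases (t : R) : 0 <= t <= 1 -> [\/ t = 0, t = 1 | 0 < t < 1].
Proof.
case/andP=> t0 t1; have [->|tn0] := eqVneq t 0; first exact: Or31.
have [->|tn1] := eqVneq t 1; first exact: Or32.
by apply: Or33; rewrite !lt_neqAle t0 t1 tn1 eq_sym tn0.
Qed.

Lemma between_lt (t a b : R) : 0 < t < 1 -> a < b ->
  a < (1 - t) * a + t * b < b.
Proof.
case/andP=> t0 t1 ab; have t2 : 0 < 1 - t by lra.
by apply/andP; split; nra.
Qed.

Lemma between_param (a b c : R) : a < c < b ->
  exists2 t, 0 < t < 1 & c = (1 - t) * a + t * b.
Proof.
case/andP=> ac cb; have ab : 0 < b - a by lra.
exists ((c - a) / (b - a)); last by field; rewrite gt_eqF.
by rewrite divr_gt0 ?ltr_pdivrMr ?mul1r //; lra.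
Qed.

Lemma ends_eq (a b c d p : R) : a < p < b -> c < p < d ->
  ~ a < c < b -> ~ a < d < b -> ~ c < a < d -> ~ c < b < d -> a = c /\ b = d.
Proof.
case/andP=> ap pb /andP[cp pd] h1 h2 h3 h4; split.
  have [ac|ca|//] := ltgtP a c; exfalso; [apply: h1|apply: h3]; lra.
have [bd|db|//] := ltgtP b d; exfalso; [apply: h4|apply: h2]; lra.
Qed.

Variables (x x' : J -> pt) (s s' : I -> R) (base : (I -> bool) -> pt * pt).
Hypothesis D : dmodel u v k x x' s s'.
Let M := dmodel_l D.
Let M' := dmodel_r D.
Notation l := (lf u v x s).
Notation l' := (lf u v x' s').
Notation G0 := (G0 u v k x x' s s').
Notation G1 := (G1 u v k x x' s s').
Notation G2 := (G2 u v k x x' s s' base).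
Notation compat := (compat u v x s).
Notation onE := (onE u v k x s).
Notation onK := (onK u v x s).

Lemma G0_D2l w : G0 w -> D2 w.1. Proof. by case/(G0_D2 D). Qed.

Lemma compat_refl p : compat p p.
Proof. by move=> i; rewrite -expr2 sqr_ge0. Qed.

(** A point may be the crossing of several pairs of leaves. Leaves of one kind through it coincide,
    hence so do their images, and the image crossings agree. *)
Lemma G0_fun w z : G0 w -> G0 z -> w.1 = z.1 -> w = z.
Proof.
move=> gw gz e.
have [S|nS] := pselect (S1 w.1).
  have [j ew] := G0_S1l D gw S.
  have [j' ez] := G0_S1l D gz (eq_ind _ (@S1 R) S _ e).
  by move: e; rewrite ew ez /= => /(model_inj M) ->.
have notx j y : y.1 = w.1 -> y <> (x j, x' j).
  by move=> ey h; apply: nS; rewrite -ey h; exact: model_S1 M j.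
case: gw => [[j]|[D1 Dw2 [i [m [ki km [i1 m1] [i2 m2]]]]]]; first by move/(notx j _ erefl).
case: gz => [[j]|[_ _ [a [b [ka kb [a1 b1] [a2 b2]]]]]]; first by move/(notx j _ (esym e)).
have tr n n' : k n = k n' -> l n w.1 = 0 -> l n' w.1 = 0 -> l' n w.2 = 0 -> l' n' w.2 = 0.
  move=> kn n1 n1'; have [hu hv] := same_leaf_ends M kn D1 nS n1 n1'.
  by apply: (ends_vanish M') => //; apply: sg_eq0 (dmodel_sg D _ _) _.
rewrite [w]surjective_pairing [z]surjective_pairing e; congr pair.
rewrite -e in a1 b1.
apply: (kinds_meet_once M' (i := a) (m := b)) => //; first by rewrite ka kb.
  by apply: (tr i) => //; rewrite ki ka.
by apply: (tr m) => //; rewrite km kb.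
Qed.

Lemma G0_G1 w : G0 w -> G1 w.
Proof.
move=> g; exists 0, w, w; rewrite cvW0; split=> //; first by rewrite lexx ler01.
  exact: compat_refl.
exact: onE_onK (G0_onE D g).
Qed.

Lemma G1_D2 w : G1 w -> D2 w.1.
Proof. by move=> [t [e [g [t01 [Ge Gg] _ -> _]]]]; apply: D2_cv => //; exact: G0_D2l. Qed.

Lemma G1_E w : G1 w -> onE w.1 -> G0 w.
Proof.
move=> [t [e [g [/unit_cases t01 [Ge Gg] c -> _]]]] E.
case: t01 E => [->|->|t01 E]; rewrite ?cvW0 ?cvW1 //.
have eg : e = g.
  by apply: G0_fun => //; apply: (extreme M t01 _ _ c E); exact: G0_D2l.
by rewrite eg cvWpp.
Qed.

(** In the affine coordinate of a leaf, extremality says that no vertex is strictly between two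
    compatible points. *)
Lemma no_between (p q r X Y : pt) a b c : X <> Y ->
  p = cv a X Y -> q = cv b X Y -> r = cv c X Y ->
  D2 p -> D2 q -> compat p q -> onE r -> ~ a < c < b.
Proof.
move=> XY ep eq er Dp Dq cpq Er acb; have [t t01 ec] := between_param acb.
have pq : p = q by apply: (extreme M t01) => //; rewrite ep eq cv_cv -ec -er.
have : a < b by case/andP: acb; exact: lt_trans.
by rewrite (cv_inj XY (etrans (esym ep) (etrans pq eq))) ltxx.
Qed.

(** Off the vertices, two edges through one point lie on the same leaf and have the same ends,
    possibly in the opposite order. *)
Lemma G1_fun w z : G1 w -> G1 z -> w.1 = z.1 -> w = z.
Proof.
move=> gw gz wz; have [E|nE] := pselect (onE w.1).
  by apply: G0_fun => //; apply: G1_E => //; rewrite -wz.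
move: gw gz => [t [e [g [/unit_cases t01 [Ge Gg] c ew K]]]].
move=> [r [h [q [/unit_cases r01 [Gh Gq] c' ez _]]]].
have E y : G0 y -> onE y.1 by move=> Gy; exact: (G0_onE D Gy).
case: t01 => [t0|t1|t01].
- by case: nE; rewrite ew t0 cvW0; exact: E.
- by case: nE; rewrite ew t1 cvW1; exact: E.
case: r01 => [r0|r1|r01].
- by case: nE; rewrite wz ez r0 cvW0; exact: E.
- by case: nE; rewrite wz ez r1 cvW1; exact: E.
have [i wi] : exists i, l i w.1 = 0 by case: K => // S; case: nE; left.
have zi : l i z.1 = 0 by rewrite -wz.
have [ei gi] : l i e.1 = 0 /\ l i g.1 = 0.
  by apply: (lf_cv_eq0 t01 (c i)); rewrite -wi ew.
have [hi qi] : l i h.1 = 0 /\ l i q.1 = 0.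
  by apply: (lf_cv_eq0 r01 (c' i)); rewrite -zi ez.
have XY := xuv M (i := i).
have [a _ ea] := lf_chord M (G0_D2l Ge) ei.
have [b _ eb] := lf_chord M (G0_D2l Gg) gi.
have [a' _ ea'] := lf_chord M (G0_D2l Gh) hi.
have [b' _ eb'] := lf_chord M (G0_D2l Gq) qi.
have pp : (1 - t) * a + t * b = (1 - r) * a' + r * b'.
  apply: (cv_inj XY); rewrite -!cv_cv -ea -eb -ea' -eb'.
  by move: wz; rewrite ew ez.
have ab : a <> b.
  move=> ab; apply: nE; rewrite ew /= ea eb -ab cvpp -ea; exact: E.
have ab' : a' <> b'.
  move=> ab'; apply: nE; rewrite wz ez /= ea' eb' -ab' cvpp -ea'; exact: E.
(* Neither edge has an end of the other in its interior. Four versions are needed, since each edge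
   may run either way along the leaf. *)
have nb1 y o (ey : y = cv o _ _) (Ey : onE y) :=
  no_between XY ea eb ey (G0_D2l Ge) (G0_D2l Gg) c Ey.
have nb2 y o (ey : y = cv o _ _) (Ey : onE y) :=
  no_between XY eb ea ey (G0_D2l Gg) (G0_D2l Ge) (compatC c) Ey.
have nb3 y o (ey : y = cv o _ _) (Ey : onE y) :=
  no_between XY ea' eb' ey (G0_D2l Gh) (G0_D2l Gq) c' Ey.
have nb4 y o (ey : y = cv o _ _) (Ey : onE y) :=
  no_between XY eb' ea' ey (G0_D2l Gq) (G0_D2l Gh) (compatC c') Ey.
have same : a = a' -> b = b' -> w = z.
  move=> aa bb; have eh : e = h by apply: G0_fun => //; rewrite ea ea' aa.
  have gq : g = q by apply: G0_fun => //; rewrite eb eb' bb.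
  rewrite ew ez -eh -gq; congr cvW.
  move: wz; rewrite ew ez -eh -gq /= => /cv_inj; apply.
  by rewrite ea eb => /(cv_inj XY).
have opp : a = b' -> b = a' -> w = z.
  move=> ab2 ba2; have eq : e = q by apply: G0_fun => //; rewrite ea eb' ab2.
  have gh : g = h by apply: G0_fun => //; rewrite eb ea' ba2.
  rewrite ew ez -eq -gh [RHS]cvWC; congr cvW.
  move: wz; rewrite ew ez -eq -gh /= [RHS]cvC => /cv_inj; apply.
  by rewrite ea eb => /(cv_inj XY).
have Ea := E _ Ge; have Eb := E _ Gg; have Ea' := E _ Gh; have Eb' := E _ Gq.
have lt_p : a < b -> a < (1 - t) * a + t * b < b by exact: between_lt.
have gt_p : b < a -> b < (1 - t) * a + t * b < a.
  rewrite (_ : _ + _ = (1 - (1 - t)) * b + (1 - t) * a); last by ring.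
  by apply: between_lt; lra.
have lt_p' : a' < b' -> a' < (1 - t) * a + t * b < b'.
  by rewrite pp; exact: between_lt.
have gt_p' : b' < a' -> b' < (1 - t) * a + t * b < a'.
  rewrite pp (_ : _ + _ = (1 - (1 - r)) * b' + (1 - r) * a'); last by ring.
  by apply: between_lt; lra.
have [lt1|lt1|//] := ltgtP a b; have [lt2|lt2|//] := ltgtP a' b'.
- by case: (ends_eq (lt_p lt1) (lt_p' lt2)); [exact: nb1 ea' _|exact: nb1 eb' _|
    exact: nb3 ea _|exact: nb3 eb _|exact: same].
- by case: (ends_eq (lt_p lt1) (gt_p' lt2)); [exact: nb1 eb' _|exact: nb1 ea' _|
    exact: nb4 ea _|exact: nb4 eb _|exact: opp].
- by case: (ends_eq (gt_p lt1) (lt_p' lt2)); [exact: nb2 ea' _|exact: nb2 eb' _|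
    exact: nb3 eb _|exact: nb3 ea _|move=> ? ?; exact: opp].
by case: (ends_eq (gt_p lt1) (gt_p' lt2)); [exact: nb2 eb' _|exact: nb2 ea' _|
  exact: nb4 eb _|exact: nb4 ea _|move=> ? ?; exact: same].
Qed.

(* A cone over a boundary point degenerates, inside [onK], to an edge. *)
Lemma cone_onK e b t : 0 <= t <= 1 -> G0 e -> G1 b -> compat e.1 b.1 ->
  onK (cvW t e b).1 -> G1 (cvW t e b).
Proof.
move=> /unit_cases[->|->|t01] Ge Gb c K; rewrite ?cvW0 ?cvW1 //; first exact: G0_G1.
have t01' : 0 <= t <= 1 by lra.
case: K => [S|[i Ki]].
  have eb : e.1 = b.1 by apply: (S1_cv t01 _ _ S); [exact: G0_D2l|exact: G1_D2].
  by rewrite -(G1_fun (G0_G1 Ge) Gb eb) cvWpp; exact: G0_G1.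
have [ei bi] : l i e.1 = 0 /\ l i b.1 = 0 by apply: (lf_cv_eq0 t01 (c i)).
have [Eb|nEb] := pselect (onE b.1).
  by exists t, e, b; split=> //; [split=> //; exact: G1_E|right; exists i].
have Ki' : onK (cvW t e b).1 by right; exists i.
have Db := G1_D2 Gb.
case: Gb => r [g [h [/unit_cases r01 [Gg Gh] gh eb _]]].
have E y : G0 y -> onE y.1 by move=> Gy; exact: (G0_onE D Gy).
case: r01 => [r0|r1|r01].
- by case: nEb; rewrite eb r0 cvW0; exact: E.
- by case: nEb; rewrite eb r1 cvW1; exact: E.
have [gi hi] : l i g.1 = 0 /\ l i h.1 = 0.
  by apply: (lf_cv_eq0 r01 (gh i)); rewrite -bi eb.
have XY := xuv M (i := i).
have [a _ ea] := lf_chord M (G0_D2l Ge) ei.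
have [p _ ep] := lf_chord M (G0_D2l Gg) gi.
have [q _ eq] := lf_chord M (G0_D2l Gh) hi.
have ebp : b.1 = cv ((1 - r) * p + r * q) (x (u i)) (x (v i)).
  by rewrite eb /= ep eq cv_cv.
have pq : p <> q.
  move=> pq; apply: nEb; rewrite eb /= ep eq -pq cvpp -ep; exact: E.
have De := G0_D2l Ge; have Dg := G0_D2l Gg; have Dh := G0_D2l Gh.
have nb1 y o (ey : y = cv o _ _) (Ey : onE y) := no_between XY ea ebp ey De Db c Ey.
have nb2 y o (ey : y = cv o _ _) (Ey : onE y) := no_between XY ebp ea ey Db De (compatC c) Ey.
have nb3 := no_between XY ep eq ea Dg Dh gh (E _ Ge).
have nb4 := no_between XY eq ep ea Dh Dg (compatC gh) (E _ Ge).
(* The vertex [e] is not inside the edge from [g] to [h], and neither [g] nor [h] is strictly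
   between [e] and [b], while [b] is inside that edge; so [e] is an end of it. *)
have [ap|aq] : a = p \/ a = q.
- have [lt|lt|//] := ltgtP p q.
    have /andP[pb bq] := between_lt r01 lt.
    have [ap|pa|->] := ltgtP a p; [|right|by left].
      by case: (nb1 _ _ ep (E _ Gg)); rewrite ap.
    have [aq|qa|//] := ltgtP a q; first by case: nb3; rewrite pa.
    by case: (nb2 _ _ eq (E _ Gh)); rewrite bq.
  have r01' : 0 < 1 - r < 1 by lra.
  have := between_lt r01' lt.
  have -> : (1 - (1 - r)) * q + (1 - r) * p = (1 - r) * p + r * q by ring.
  case/andP=> qb bp.
  have [aq|qa|->] := ltgtP a q; [|left|by right].
    by case: (nb1 _ _ eq (E _ Gh)); rewrite aq.
  have [ap|pa|//] := ltgtP a p; first by case: nb4; rewrite qa.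
  by case: (nb2 _ _ ep (E _ Gg)); rewrite bp.
- have eg : e = g by apply: G0_fun => //; rewrite ea ep ap.
  (* The weights of the two nested combinations multiply, the vertex being [g]. *)
  exists (t * r), g, h; split=> //.
    by case/andP: t01 => ? ?; case/andP: r01 => ? ?; apply/andP; split; nra.
  by rewrite eg eb /cvW /=; congr pair; apply: ptP; rewrite /cv /=; ring.
have eh : e = h by apply: G0_fun => //; rewrite ea eq aq.
(* Here the vertex is [h], which gets [1 - t] directly and [t * r] through [b]. *)
exists (1 - t + t * r), g, h; split=> //.
  by case/andP: t01 => ? ?; case/andP: r01 => ? ?; apply/andP; split; nra.
by rewrite eh eb /cvW /=; congr pair; apply: ptP; rewrite /cv /=; ring.
Qed.

Lemma G2_onK w : G2 w -> onK w.1 -> G1 w.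
Proof. by move=> [t [e [b [t01 [Ge Gb] c -> _]]]]; exact: cone_onK. Qed.

Lemma G1_G2 w : G1 w -> G2 w.
Proof.
move=> [t [e [g [t01 [Ge Gg] c ew K]]]]; exists t, e, g.
by split=> //; [split=> //; exact: G0_G1|left].
Qed.

(** Since [t < r], the point [c] is strictly between [e] and [b], so a leaf through [c] contains the
    whole segment. Thus a ray from the cone vertex with inner points off [onK] has only one possible
    end. *)
Lemma onK_ray e b c t r : compat e b -> D2 e -> D2 b -> onK c ->
  cv t e b = cv r e c -> 0 < t < r -> onK (cv t e b).
Proof.
move=> eb De Db K ee /andP[t0 tr].
have r0 : r != 0 by rewrite gt_eqF // (lt_trans t0).
have ec : c = cv (t / r) e b.
  have e1 : (cv t e b).1 = (cv r e c).1 by rewrite ee.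
  have e2 : (cv t e b).2 = (cv r e c).2 by rewrite ee.
  move: e1 e2; rewrite /cv /= => e1 e2.
  apply: ptP; apply: (mulfI r0); rewrite /=.
    have -> : r * c.1 = (1 - t) * e.1 + t * b.1 - (1 - r) * e.1 by rewrite e1; ring.
    by field.
  have -> : r * c.2 = (1 - t) * e.2 + t * b.2 - (1 - r) * e.2 by rewrite e2; ring.
  by field.
have tr01 : 0 < t / r < 1.
  by rewrite divr_gt0 ?ltr_pdivrMr ?mul1r //; apply: lt_trans tr.
case: K => [S|[i ci]].
  have e_b : e = b by apply: (S1_cv tr01) => //; rewrite -ec.
  by left; rewrite e_b cvpp; move: S; rewrite ec e_b cvpp.
have [ei bi] : l i e = 0 /\ l i b = 0.
  by apply: (lf_cv_eq0 tr01 (eb i)); rewrite -ec.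
by right; exists i; rewrite lf_cv ei bi !mulr0 addr0.
Qed.

(** Off the leaves both cones have the same vertex, prescribed by [base], and it remains to compare
    two segments on one ray. *)
Lemma G2_fun w z : G2 w -> G2 z -> w.1 = z.1 -> w = z.
Proof.
move=> gw gz wz; have [K|nK] := pselect (onK w.1).
  by apply: G1_fun => //; apply: G2_onK => //; rewrite -wz.
move: gw gz => [t [e [b [/unit_cases t01 [Ge Gb] eb ew bw]]]].
move=> [r [f [c [/unit_cases r01 [Gf Gc] fc ez bz]]]].
have ef : e = f.
  by case: bw => // ->; case: bz => [|->]; rewrite -wz.
subst f.
have Ke : onK e.1 by exact: onE_onK (G0_onE D Ge).
have Kb : onK b.1 by case: (Gb) => ? [? [? []]].
have Kc : onK c.1 by case: (Gc) => ? [? [? []]].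
have ee : cv t e.1 b.1 = cv r e.1 c.1 by move: wz; rewrite ew ez.
have pos y h : [\/ y = 0, y = 1 | 0 < y < 1] -> w.1 = cv y e.1 h -> 0 < y.
  by case=> [->|->|/andP[]//] ee'; [case: nK; rewrite ee' cv0|exact: ltr01].
have t0 : 0 < t by apply: (pos _ b.1) => //; rewrite ew.
have r0 : 0 < r by apply: (pos _ c.1) => //; rewrite wz ez.
have De := G0_D2l Ge; have Db := G1_D2 Gb; have Dc := G1_D2 Gc.
have [tr|rt|tr] := ltgtP t r.
- by case: nK; rewrite ew; apply: (onK_ray eb De Db Kc ee); rewrite t0.
- by case: nK; rewrite wz ez; apply: (onK_ray fc De Dc Kb (esym ee)); rewrite r0.
rewrite ew ez -tr; congr cvW; apply: G1_fun => //.
have t0' : t != 0 by rewrite gt_eqF.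
rewrite -tr in ee.
have e1 : (cv t e.1 b.1).1 = (cv t e.1 c.1).1 by rewrite ee.
have e2 : (cv t e.1 b.1).2 = (cv t e.1 c.1).2 by rewrite ee.
move: e1 e2; rewrite /cv /= => /addrI /(mulfI t0') e1 /addrI /(mulfI t0') e2.
exact: ptP.
Qed.

End Uniqueness.

(** * The edge and cone graphs are symmetric *)

Section Symmetry.
Variables (R : realType) (I J : Type) (u v : I -> J) (k : I -> bool).
Notation pt := (R * R)%type.
Variables (x x' : J -> pt) (s s' : I -> R) (base : (I -> bool) -> pt * pt).
Hypothesis D : dmodel u v k x x' s s'.

Lemma G1_onKr w : G1 u v k x x' s s' w -> onK u v x' s' w.2.
Proof.
move=> gw; have aw := G1_agree D gw.
have [S|nS] := pselect (S1 w.1).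
  have [j ->] := G0_S1l D (G1_E D gw (or_introl S)) S.
  by left; exact: model_S1 (dmodel_r D) j.
case: gw => ? [? [? [_ _ _ _ [//|[i wi]]]]].
by right; exists i; exact: sg_eq0 (aw i) wi.
Qed.

Lemma G1_sym w : G1 u v k x x' s s' w -> G1 u v k x' x s' s (swap_pair w).
Proof.
move=> gw; have K := G1_onKr gw.
case: gw K => t [e [g [t01 [Ge Gg] c -> _]]] K.
exists t, (swap_pair e), (swap_pair g); split=> //; first by split; exact: G0_sym.
exact: agree_compat (G0_agree D Ge) (G0_agree D Gg) c.
Qed.

(** Because [base] depends only on this pattern, the cone vertex is the same seen from either
    side. *)
Lemma sigma_agree w : agree u v x x' s s' w -> sigma u v x s w.1 = sigma u v x' s' w.2.
Proof. by move=> a; apply/funext => i; rewrite /sigma -sgr_gt0 a sgr_gt0. Qed.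

Lemma G2_sym w : G2 u v k x x' s s' base w ->
  G2 u v k x' x s' s (swap_pair \o base) (swap_pair w).
Proof.
move=> gw; have aw := G2_agree D gw.
have [K|nK] := pselect (onK u v x s w.1).
  by apply: G1_G2; [exact: dmodel_sym D|exact: G1_sym (G2_onK D gw K)].
case: gw aw nK => t [e [b [t01 [Ge Gb] c ew [//|eb]]]] aw _.
exists t, (swap_pair e), (swap_pair b); split=> //.
- by split; [exact: G0_sym|exact: G1_sym].
- exact: agree_compat (G0_agree D Ge) (G1_agree D Gb) c.
- by rewrite ew.
by right; rewrite /= -(sigma_agree aw) eb.
Qed.

End Symmetry.

(** * The correspondence is closed *)

Section Closedness.
Variables (R : realType) (I J : Type) (u v : I -> J) (k : I -> bool).
Notation pt := (R * R)%type.

Definition unit_seg : set R := [set t | 0 <= t <= 1].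

Lemma unit_seg_compact : compact unit_seg.
Proof.
have -> : unit_seg = `[0, 1]%classic by apply/seteqP; split=> t /=; rewrite in_itv.
exact: segment_compact.
Qed.

Lemma plane2_hausdorff : hausdorff_space (pt * pt)%type.
Proof. exact: norm_hausdorff. Qed.

Lemma compact_closed2 (A : set (pt * pt)) : compact A -> closed A.
Proof. exact: compact_closed plane2_hausdorff. Qed.

Lemma continuous_cvW (T : topologicalType) (f : T -> R) (g h : T -> pt * pt) :
  continuous f -> continuous g -> continuous h ->
  continuous (fun z => cvW (f z) (g z) (h z)).
Proof.
move=> cf cg ch.
have cg1 := continuous_fst (continuous_fst cg); have cg2 := continuous_snd (continuous_fst cg).
have cg3 := continuous_fst (continuous_snd cg); have cg4 := continuous_snd (continuous_snd cg).
have ch1 := continuous_fst (continuous_fst ch); have ch2 := continuous_snd (continuous_fst ch).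
have ch3 := continuous_fst (continuous_snd ch); have ch4 := continuous_snd (continuous_snd ch).
have c1 := continuous_add (@continuous_const T R 1) (continuous_opp cf).
have mix a b (ca : continuous a) (cb : continuous b) :=
  continuous_add (continuous_mul c1 ca) (continuous_mul cf cb).
by apply: continuous_pair; apply: continuous_pair; exact: mix.
Qed.

Lemma nbhs_disc (q : pt) (N : set pt) : nbhs q N ->
  exists2 e, 0 < e & forall p, dsq q p < e -> N p.
Proof.
have sq (a e : R) : 0 < e -> a ^+ 2 < e ^+ 2 -> `|a| < e.
  move=> e0; rewrite -real_normK ?num_real //; have := normr_ge0 a.
  by move: `|a| => y y0 h; rewrite ltNge; apply/negP => ey; nra.
move=> /nbhs_ballP[e /= e0 eN]; exists (e ^+ 2); first by rewrite exprn_gt0.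
move=> p pe; apply: eN.
split; rewrite -ball_normE /ball_ /=; apply: sq => //; apply: le_lt_trans pe;
  by rewrite /dsq ?lerDl ?lerDr sqr_ge0.
Qed.

Lemma disc_nbhs (q : pt) e : 0 < e -> nbhs q [set p | dsq q p < e].
Proof.
move=> e0; have -> : [set p | dsq q p < e] = [set p | 0 < e - dsq q p].
  by apply/seteqP; split=> p /=; rewrite subr_gt0.
apply: open_nbhs_nbhs; split; first by apply: open_gt0; rewrite /dsq; cts.
by rewrite /= /dsq !subrr expr0n /= addr0 subr0.
Qed.

Variables (x x' : J -> pt) (s s' : I -> R) (base : (I -> bool) -> pt * pt).
Hypothesis D : dmodel u v k x x' s s'.
Let M := dmodel_l D.
Let M' := dmodel_r D.
Notation l := (lf u v x s).
Notation l' := (lf u v x' s').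
Notation G0 := (G0 u v k x x' s s').
Notation G1 := (G1 u v k x x' s s').
Notation G2 := (G2 u v k x x' s s' base).
Notation compat := (compat u v x s).
Notation onE := (onE u v k x s).
Notation onK := (onK u v x s).

(** The two parameters are independent: every point of a leaf is paired with every point of its
    image. Intersecting the bands of the two kinds recovers [G0]. *)
Definition band b : set (pt * pt) :=
  (fun z : ((pt * pt) * (pt * pt)) * (R * R) =>
    (cv z.2.1 z.1.1.1 z.1.2.1, cv z.2.2 z.1.1.2 z.1.2.2)) @`
  (Lam u v k x x' b `*` (unit_seg `*` unit_seg)).

Lemma band_compact b : compact (band b).
Proof.
apply: continuous_compact; first by apply: continuous_subspaceT; rewrite /cv; cts.
apply: compact_setX; first by have := @dmodel_compact _ _ _ _ _ _ _ _ _ _ D b.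
by apply: compact_setX; exact: unit_seg_compact.
Qed.

Lemma bandP b w : band b w <-> (exists j, w = (x j, x' j)) \/
  (exists i, [/\ k i = b, D2 w.1, D2 w.2, l i w.1 = 0 & l' i w.2 = 0]).
Proof.
split.
  move=> [[z [t t']] /= [L [t01 t01']] <-].
  case: L => [[i ki ->]|[j ->]] /=; last by left; exists j; rewrite !cvpp.
  right; exists i; split=> //=.
  - by apply: D2_cv => //; exact: S1_D2 (model_S1 M _).
  - by apply: D2_cv => //; exact: S1_D2 (model_S1 M' _).
  - by rewrite lf_cv lf_u lf_v !mulr0 addr0.
  by rewrite lf_cv lf_u lf_v !mulr0 addr0.
case=> [[j ->]|[i [ki D1 Dw2 i1 i2]]].
  exists (((x j, x' j), (x j, x' j)), (0, 0)); last by rewrite /= !cv0.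
  by split; [right; exists j|split; rewrite /unit_seg /= lexx ler01].
have [t t01 e1] := lf_chord M D1 i1; have [t' t01' e2] := lf_chord M' Dw2 i2.
exists (((x (u i), x' (u i)), (x (v i), x' (v i))), (t, t')).
  by split; [left; exists i|split].
by rewrite /= -e1 -e2 -surjective_pairing.
Qed.

Lemma G0_bands : G0 = band true `&` band false.
Proof.
apply/seteqP; split=> w.
  case=> [[j ->]|[D1 Dw2 [i [m [ki km [i1 m1] [i2 m2]]]]]].
    by split; apply/bandP; left; exists j.
  by split; apply/bandP; right; [exists i|exists m].
case=> /bandP[[j ->] _|[i [ki D1 Dw2 i1 i2]]]; first by left; exists j.
move=> /bandP[[j ->]|[m [km _ _ m1 m2]]]; first by left; exists j.
by right; split=> //; exists i, m.
Qed.

Lemma G0_compact : compact G0.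
Proof.
by rewrite G0_bands; apply: compact_closedI; [|apply: compact_closed2];
  exact: band_compact.
Qed.

Definition Kof b : set pt := [set p | D2 p /\ (S1 p \/ exists2 i, k i = b & l i p = 0)].

(** It is a projection of the compact band. *)
Lemma Kof_closed b : closed (Kof b).
Proof.
have -> : Kof b = fst @` band b.
  apply/seteqP; split=> p.
    move=> [Dp [S|[i ki ip]]].
      have [j xj] := model_surj M S; exists (x j, x' j) => //.
      by apply/bandP; left; exists j.
    exists (p, x' (u i)) => //; apply/bandP; right; exists i; split=> //=.
      exact: S1_D2 (model_S1 M' _).
    exact: lf_u.
  move=> [w /bandP[[j ->]|[i [ki D1 _ i1 _]]] <-] /=.
    by have S := model_S1 M j; split; [exact: S1_D2|left].
  by split=> //; right; exists i.
apply: compact_closed; first exact: plane_hausdorff.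
apply: continuous_compact; last by have := @band_compact b.
apply: continuous_subspaceT; exact: (continuous_fst (@continuous_id _)).
Qed.

Lemma onK_Kof p : D2 p -> onK p <-> (Kof true `|` Kof false) p.
Proof.
move=> Dp; split.
  case=> [S|[i ip]]; first by left; split=> //; left.
  by case ki: (k i); [left|right]; split=> //; right; exists i.
by case=> -[_ [S|[i _ ip]]]; by [left|right; exists i].
Qed.

Lemma closed_compat (T : topologicalType) (f g : T -> pt) :
  continuous f -> continuous g -> closed [set z | compat (f z) (g z)].
Proof.
move=> cf cg.
have cl i (h : T -> pt) (ch : continuous h) : continuous (fun z => l i (h z)).
  have ch1 := continuous_fst ch; have ch2 := continuous_snd ch.
  have shift (a : T -> R) c (ca : continuous a) :=
    continuous_add ca (@continuous_const T R c).
  rewrite /lf /det; apply: continuous_mul; first exact: continuous_const.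
  apply: continuous_add; last apply: continuous_opp.
    by apply: continuous_mul; [exact: continuous_const|exact: shift].
  by apply: continuous_mul; [exact: continuous_const|exact: shift].
have -> : [set z | compat (f z) (g z)] =
    \bigcap_(i in [set: I]) [set z | 0 <= l i (f z) * l i (g z)].
  by apply/seteqP; split=> z /= h i; [move=> _|]; exact: h.
apply: closed_bigI => i _; apply: closed_ge0.
by apply: continuous_mul; exact: cl.
Qed.

Definition cone_param : set (R * ((pt * pt) * (pt * pt))) :=
  [set z | compat z.2.1.1 z.2.2.1].

Lemma continuous_cone :
  continuous (fun z : R * ((pt * pt) * (pt * pt)) => cvW z.1 z.2.1 z.2.2).
Proof.
have c := @continuous_id (R * ((pt * pt) * (pt * pt)))%type.
exact: continuous_cvW (continuous_fst c) (continuous_fst (continuous_snd c))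
  (continuous_snd (continuous_snd c)).
Qed.

Lemma cone_closed : closed cone_param.
Proof.
have c := @continuous_id (R * ((pt * pt) * (pt * pt)))%type.
exact: closed_compat (continuous_fst (continuous_fst (continuous_snd c)))
  (continuous_fst (continuous_snd (continuous_snd c))).
Qed.

Lemma G1_compact : compact G1.
Proof.
pose phi (z : R * ((pt * pt) * (pt * pt))) := cvW z.1 z.2.1 z.2.2.
have -> : G1 = phi @` (((unit_seg `*` (G0 `*` G0)) `&` cone_param) `&`
    ((fun z => (phi z).1) @^-1` (Kof true `|` Kof false))).
  apply/seteqP; split=> w.
    move=> [t [e [g [t01 [Ge Gg] c -> K]]]]; exists (t, (e, g)) => //.
    split; first by split=> //; split=> //.
    by apply/onK_Kof => //=; apply: D2_cv => //; exact: (G0_D2l D).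
  move=> [[t [e g]] [[[/= t01 [Ge Gg]] c] /= K] <-].
  exists t, e, g; split=> //; apply/onK_Kof => //.
  by apply: D2_cv => //; exact: (G0_D2l D).
apply: continuous_compact; first by apply: continuous_subspaceT; exact: continuous_cone.
apply: compact_closedI; last first.
  apply: closed_preimage; last by apply: closedU; exact: Kof_closed.
  exact: continuous_fst continuous_cone.
apply: compact_closedI; last exact: cone_closed.
apply: compact_setX; first exact: unit_seg_compact.
by apply: compact_setX; exact: G0_compact.
Qed.

(** One neighbourhood serves all leaves of a kind, however many accumulate: a disc around [q] that
    misses their closed union, since a leaf separating [p] from [q] would cut the segment between
    them. *)
Lemma same_side_near b q : D2 q -> ~ S1 q -> (forall i, k i = b -> l i q <> 0) ->
  exists2 N, nbhs q N &
    forall p, N p -> D2 p -> forall i, k i = b -> 0 < l i q * l i p.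
Proof.
move=> Dq nS nl.
have nK : nbhs q (~` Kof b).
  apply: open_nbhs_nbhs; split; first exact/closed_openC/Kof_closed.
  by case=> _ [//|[i ki iq]]; exact: nl iq.
have [e e0 he] := nbhs_disc nK.
exists [set p | dsq q p < e]; first exact: disc_nbhs.
move=> p /= pe Dp i ki; rewrite ltNge; apply/negP => h.
have [p0|p0] := eqVneq (l i p) 0.
  by case: (he p pe); split=> //; right; exists i.
have iq : l i q != 0 by apply/eqP/nl.
have {}h : l i q * l i p < 0 by rewrite lt_neqAle h andbT mulf_neq0.
have [t /andP[t0 t1] et] := sign_change_cv h.
apply: (he (cv t q p)).
  apply: le_lt_trans pe; have d0 := dsq_ge0 q p.
  have -> : dsq q (cv t q p) = t ^+ 2 * dsq q p by rewrite /dsq /cv /=; ring.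
  by rewrite ler_piMl // expr_le1 // ltW.
split; first by apply: D2_cv => //; rewrite !ltW.
by right; exists i => //; rewrite lf_cv.
Qed.

Lemma sigma_near q : D2 q -> ~ onK q -> exists2 N, nbhs q N &
  forall p, N p -> D2 p -> ~ onK p /\ sigma u v x s p = sigma u v x s q.
Proof.
move=> Dq nK; have nS : ~ S1 q by move=> S; apply: nK; left.
have nl b i : k i = b -> l i q <> 0 by move=> _ iq; apply: nK; right; exists i.
have [N1 n1 h1] := same_side_near Dq nS (nl true).
have [N2 n2 h2] := same_side_near Dq nS (nl false).
have nO : nbhs q (~` @S1 R).
  apply: open_nbhs_nbhs; split=> //; apply: closed_openC.
  exact: compact_closed (@plane_hausdorff R) (@compact_S1 R).
exists ((N1 `&` N2) `&` ~` @S1 R); first by apply: filterI => //; exact: filterI.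
move=> p [[p1 p2] pS] Dp.
have pos i : 0 < l i q * l i p.
  by case ki: (k i); [exact: h1|exact: h2].
split.
  case=> [//|[i ip]]; have := pos i; by rewrite ip mulr0 ltxx.
apply/funext => i; rewrite /sigma; have := pos i.
have [qp|qn|<-] := ltgtP 0 (l i q); last by rewrite mul0r ltxx.
  by rewrite pmulr_rgt0.
by rewrite nmulr_rgt0 // => /ltW; rewrite leNgt => /negbTE.
Qed.

Lemma G2_D2 w : G2 w -> D2 w.1.
Proof.
move=> [t [e [b [t01 [Ge Gb] _ -> _]]]]; apply: D2_cv => //; first exact: (G0_D2l D).
exact: (G1_D2 D).
Qed.

Lemma G2_closed : closed G2.
Proof.
move=> q clq.
pose phi (z : R * ((pt * pt) * (pt * pt))) := cvW z.1 z.2.1 z.2.2.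
have pc (A : set (pt * pt)) : compact A ->
    closed (phi @` ((unit_seg `*` (A `*` G1)) `&` cone_param)).
  move=> cA; apply: compact_closed2; apply: continuous_compact.
    by apply: continuous_subspaceT; exact: continuous_cone.
  apply: compact_closedI; last exact: cone_closed.
  apply: compact_setX; first exact: unit_seg_compact.
  by apply: compact_setX => //; exact: G1_compact.
(* Forgetting which vertex is prescribed gives a compact set of cones, so the limit [q] is still on
   some cone. *)
have [[t [e b]] [[/= t01 [Ge Gb]] c] eq] :
    (phi @` ((unit_seg `*` (G0 `*` G1)) `&` cone_param)) q.
  apply: (pc _ G0_compact) => B nB; have [w [Gw Bw]] := clq B nB.
  exists w; split=> //; case: Gw => t [e [b [t01 [Ge Gb] c -> _]]].
  by exists (t, (e, b)) => //; split=> //; split=> //.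
have Dq : D2 q.1.
  by rewrite -eq; apply: D2_cv => //; [exact: (G0_D2l D)|exact: (G1_D2 D)].
(* On the leaves the definition of [G2] allows any vertex. Off them the pattern is locally constant,
   so the nearby cones all have the vertex [e0]. *)
have [K|nK] := pselect (onK q.1).
  by exists t, e, b; split=> //; left.
have [N nN hN] := sigma_near Dq nK.
have nN' : nbhs q (fst @^-1` N) by exact: (@cvg_fst _ _ (nbhs q.1) (nbhs q.2) _ N nN).
pose e0 := base (sigma u v x s q.1).
have near_base w : G2 w -> N w.1 -> exists t' b',
    [/\ 0 <= t' <= 1, G0 e0, G1 b', compat e0.1 b'.1 & w = cvW t' e0 b'].
  move=> Gw Nw; have [nKw ew] := hN _ Nw (G2_D2 Gw).
  case: Gw nKw ew => t' [e' [b' [t01' [Ge' Gb'] c' ew' [//|eb]]]] _ ew.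
  exists t', b'; move: eb; rewrite ew -/e0 => eb; rewrite -eb; split=> //.
have G0e : G0 e0.
  have [w [Gw Nw]] := clq _ nN'.
  by have [t' [b' []]] := near_base _ Gw Nw.
(* The same compactness argument, now with the vertex fixed. *)
have [[t' [e' b']] [[/= t01' [ee Gb']] c'] eq'] :
    (phi @` ((unit_seg `*` ([set e0] `*` G1)) `&` cone_param)) q.
  have c1 : compact [set e0] by exact: compact_set1.
  apply: (pc _ c1) => B nB.
  have [w [Gw [Bw Nw]]] := clq _ (filterI nB nN').
  exists w; split=> //; have [t' [b' [t01' _ Gb' c' ->]]] := near_base _ Gw Nw.
  by exists (t', (e0, b')) => //; split=> //; split=> //.
move: c' eq'; rewrite /cone_param /phi /= ee => c' eq'.
by exists t', e0, b'; split=> //; right.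
Qed.

End Closedness.

(** * The correspondence is total *)

Section Totality.
Variables (R : realType) (I J : Type) (u v : I -> J) (k : I -> bool).
Notation pt := (R * R)%type.
Variables (x x' : J -> pt) (s s' : I -> R) (base : (I -> bool) -> pt * pt).
Hypothesis D : dmodel u v k x x' s s'.
Let M := dmodel_l D.
Let M' := dmodel_r D.
Notation l := (lf u v x s).
Notation l' := (lf u v x' s').
Notation G0 := (G0 u v k x x' s s').
Notation G1 := (G1 u v k x x' s s').
Notation G2 := (G2 u v k x x' s s' base).
Notation compat := (compat u v x s).
Notation onE := (onE u v k x s).
Notation onK := (onK u v x s).

Lemma continuous_ray (p y : pt) : continuous (fun t : R => cv t p y).
Proof. by rewrite /cv; cts. Qed.

(** The last parameter at which the ray from [p] towards [y] is in the disc and not separated from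
    [p]; it exists because both conditions are closed and the parameters are bounded. *)
Lemma ray_end p y : D2 p -> p <> y -> exists t, [/\ 0 <= t, D2 (cv t p y),
  compat p (cv t p y) & forall r, t < r -> D2 (cv r p y) -> ~ compat p (cv r p y)].
Proof.
move=> Dp py.
pose A : set R := [set t | [/\ 0 <= t, D2 (cv t p y) & compat p (cv t p y)]].
have A0 : A 0 by split=> //; rewrite cv0 //; exact: compat_refl.
have clA : closed A.
  have -> : A = [set t | 0 <= t] `&` ((fun t => cv t p y) @^-1` @D2 R) `&`
      [set t | compat p (cv t p y)].
    by apply/seteqP; split=> t /= => [[]|[[]]].
  apply: closedI; first apply: closedI.
  - exact: closed_ge.
  - by apply: closed_preimage; [exact: continuous_ray|exact: closed_D2].
  by apply: closed_compat; [exact: continuous_const|exact: continuous_ray].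
have d0 := dsq_gt0 py.
(* For [t] at least 1, [nsq_cv] and [nsq p <= 1] give [t * (t - 1) * dsq p y <= t]. *)
have bnd t : A t -> t <= 1 + (dsq p y)^-1.
  case=> t0; rewrite /D2 /= -/(nsq (cv t p y)) nsq_cv => h _.
  have [t1|/ltW t1] := leP 1 t; last by rewrite (le_trans t1) // lerDl invr_ge0 ltW.
  have ny : 0 <= t * nsq y by rewrite mulr_ge0 // addr_ge0 ?sqr_ge0.
  have np : (t - 1) * nsq p <= t - 1 by rewrite ler_piMr // subr_ge0.
  have e : t * ((t - 1) * dsq p y) <= t * 1 by lra.
  rewrite ler_pM2l ?(lt_le_trans ltr01) // in e.
  by rewrite -lerBlDl -[_^-1]mul1r ler_pdivlMr.
have cA : compact A.
  apply: (subclosed_compact clA (segment_compact (a := 0) (b := 1 + (dsq p y)^-1))).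
  by move=> t At; rewrite /= in_itv /= bnd // andbT; case: At.
have [c cA' cmax] := compact_EVT_max (ex_intro _ 0 A0) cA (continuous_subspaceT (@continuous_id R)).
have [c0 Dc cc] := set_mem cA'.
exists c; split=> // r cr Dr h; have := cmax r.
rewrite leNgt cr => /(_ _)/negP; apply=> //; apply/mem_set; split=> //.
exact: le_trans (ltW cr).
Qed.

Lemma open_disc_nbhs q : D2 q -> ~ S1 q -> nbhs q (@D2 R).
Proof.
move=> Dq nS; have : nbhs q [set p : pt | 0 < 1 - (p.1 ^+ 2 + p.2 ^+ 2)].
  apply: open_nbhs_nbhs; split; first by apply: open_gt0; cts.
  rewrite /= subr_gt0 lt_neqAle; move: Dq; rewrite /D2 /= => ->; rewrite andbT.
  exact/eqP.
by apply: filterS => p /=; rewrite subr_gt0 => /ltW.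
Qed.

Lemma ray_further (p y : pt) t N : nbhs (cv t p y) N -> exists2 r, t < r & N (cv r p y).
Proof.
move=> nN; have /nbhs_ballP[e /= e0 eN] := @continuous_ray p y t _ nN.
exists (t + e / 2); first by rewrite ltrDl divr_gt0.
apply: eN; rewrite -ball_normE /ball_ /= opprD addrA subrr sub0r normrN.
by rewrite gtr0_norm ?divr_gt0 // ltr_pdivrMr // ltr_pMr // ltr1n.
Qed.

Lemma product_ge0 (a b c : R) : 0 <= a * b -> 0 < b * c -> 0 <= a * c.
Proof.
have [b0|b0|<-] := ltgtP 0 b; last by rewrite mul0r ltxx.
  by rewrite pmulr_lge0 // pmulr_rgt0 // => a0 /ltW; exact: mulr_ge0.
by rewrite nmulr_lge0 // nmulr_rgt0 // => a0 /ltW; exact: mulr_le0.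
Qed.

(** An end off the circle and the leaves could be pushed further, by [same_side_near]. *)
Lemma ray_end_onK p y : D2 p -> ~ onK p -> p <> y -> exists t,
  [/\ 0 <= t, D2 (cv t p y), compat p (cv t p y) & onK (cv t p y)].
Proof.
move=> Dp nKp py; have [t [t0 Dt ct tmax]] := ray_end Dp py.
exists t; split=> //; apply: contrapT => nK.
have nS : ~ S1 (cv t p y) by move=> S; apply: nK; left.
have nl b i : k i = b -> l i (cv t p y) <> 0 by move=> _ h; apply: nK; right; exists i.
have [N1 n1 h1] := same_side_near D Dt nS (nl true).
have [N2 n2 h2] := same_side_near D Dt nS (nl false).
have [r tr [[r1 r2] Dr]] := ray_further (filterI (filterI n1 n2) (open_disc_nbhs Dt nS)).
apply: (tmax r tr Dr) => i; apply: product_ge0 (ct i) _.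
by case ki: (k i); [exact: h1|exact: h2].
Qed.

Lemma two_kinds_onE i m p : k m = ~~ k i -> l i p = 0 -> l m p = 0 -> onE p.
Proof.
by case ki: (k i) => /= km ip mp; right; [exists i, m|exists m, i].
Qed.

(** Moving along the leaf [i], only leaves of the other kind can obstruct: those of its own kind
    never have points of [i] strictly on both sides. *)
Lemma leaf_end i p y : D2 p -> ~ onE p -> l i p = 0 -> l i y = 0 -> p <> y -> exists t,
  [/\ 0 < t, D2 (cv t p y), compat p (cv t p y) & onE (cv t p y)].
Proof.
move=> Dp nEp ip iy py; have [t [t0 Dt ct tmax]] := ray_end Dp py.
have on_leaf r : l i (cv r p y) = 0 by rewrite lf_cv ip iy !mulr0 addr0.
have E : onE (cv t p y).
  apply: contrapT => nE; have nS : ~ S1 (cv t p y) by move=> S; apply: nE; left.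
  have nl m : k m = ~~ k i -> l m (cv t p y) <> 0.
    by move=> km h; apply: nE; exact: two_kinds_onE km (on_leaf t) h.
  have [N nN h] := same_side_near D Dt nS nl.
  have [r tr [Nr Dr]] := ray_further (filterI nN (open_disc_nbhs Dt nS)).
  apply: (tmax r tr Dr) => m; have [km|km] := eqVneq (k m) (k i); last first.
    by apply: product_ge0 (ct m) _; apply: h => //; move: km; case: (k m) (k i) => [] [].
  have [a /andP[a0 a1] ea] := lf_chord M Dp ip.
  have [b /andP[b0 b1] eb] := lf_chord M Dr (on_leaf r).
  (* Expanded in the values [U] and [V] at the ends of [i], the product has only nonnegative
     terms. *)
  have := model_noncross M (esym km); rewrite eb ea !lf_cv.
  move: (l m (x (u i))) (l m (x (v i))) => U V UV.
  have -> : ((1 - a) * U + a * V) * ((1 - b) * U + b * V) =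
    (1 - a) * (1 - b) * U ^+ 2 + ((1 - a) * b + a * (1 - b)) * (U * V) + a * b * V ^+ 2 by ring.
  have na : 0 <= 1 - a by rewrite subr_ge0.
  have nb : 0 <= 1 - b by rewrite subr_ge0.
  have h1 : 0 <= (1 - a) * (1 - b) * U ^+ 2 by rewrite mulr_ge0 ?sqr_ge0 ?mulr_ge0.
  have h2 : 0 <= ((1 - a) * b + a * (1 - b)) * (U * V).
    by rewrite mulr_ge0 // addr_ge0 // mulr_ge0.
  have h3 : 0 <= a * b * V ^+ 2 by rewrite mulr_ge0 ?sqr_ge0 ?mulr_ge0.
  by rewrite addr_ge0 // addr_ge0.
exists t; split=> //; rewrite lt_neqAle t0 andbT; apply/eqP => t00.
by apply: nEp; move: E; rewrite -t00 cv0.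
Qed.

(** The leaf [i] strictly separates the ends of [m], since otherwise the two would coincide. Signs
    at circle points carry over, so the image leaves cross as well. *)
Lemma G0_total p : D2 p -> onE p -> exists2 w, G0 w & w.1 = p.
Proof.
move=> Dp E; have [S|nS] := pselect (S1 p).
  by have [j xj] := model_surj M S; exists (x j, x' j) => //; left; exists j.
case: E => [//|[i [m [ki km ip mp]]]].
have [t t01 ep] := lf_chord_lt M Dp nS mp.
have kim : k i <> k m by rewrite ki km.
have UV : l i (x (u m)) * l i (x (v m)) < 0.
  move: ip; rewrite ep lf_cv => e; rewrite ltNge; apply/negP => h.
  have [|hu hv] := @lf_cv_eq0 _ _ _ u v x s i t (x (u m)) (x (v m)) t01 h.
    by rewrite lf_cv.
  exact: (kinds_distinct M kim hu hv).
have [t' t01' et'] : exists2 t, 0 < t < 1 &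
    (1 - t) * l' i (x' (u m)) + t * l' i (x' (v m)) = 0.
  apply: sign_change_cv; rewrite -sgr_lt0 sgrM -!(dmodel_sg D) -sgrM sgr_lt0.
  exact: UV.
exists (p, cv t' (x' (u m)) (x' (v m))) => //; right; split=> //=.
  apply: D2_cv; [|exact: S1_D2 (model_S1 M' _)|exact: S1_D2 (model_S1 M' _)].
  by case/andP: t01' => ? ?; rewrite !ltW.
exists i, m; split=> //; split; first by rewrite lf_cv.
by rewrite lf_cv lf_u lf_v !mulr0 addr0.
Qed.

Lemma G1_total p : D2 p -> onK p -> exists2 w, G1 w & w.1 = p.
Proof.
move=> Dp K; have [E|nE] := pselect (onE p).
  by have [w Gw wp] := G0_total Dp E; exists w => //; exact: (G0_G1 D).
have nS : ~ S1 p by move=> S; apply: nE; left.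
have [i ip] : exists i, l i p = 0 by case: K.
have pS j : p <> x j by move=> e; apply: nS; rewrite e; exact: model_S1 M j.
have [t1 [t1p D1 c1 E1]] := leaf_end Dp nE ip (lf_u u v x s i) (pS _).
have [t2 [t2p Dt2 c2 E2]] := leaf_end Dp nE ip (lf_v u v x s i) (pS _).
have [w1 G1w e1] := G0_total D1 E1; have [w2 G2w e2] := G0_total Dt2 E2.
have [a /andP[a0 a1] ep] := lf_chord_lt M Dp nS ip.
(* In the coordinate of the leaf, the ends reached from [p] lie on either side of its coordinate
   [a]. *)
have h : (1 - t1) * a < a < (1 - t2) * a + t2.
  have := mulr_gt0 t1p a0.
  have : 0 < t2 * (1 - a) by rewrite mulr_gt0 // subr_gt0.
  by move=> ? ?; apply/andP; split; lra.
have [t t01 et] := between_param h.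
have pe : p = cv t (cv t1 p (x (u i))) (cv t2 p (x (v i))).
  by rewrite {1}ep et ep; apply: ptP; rewrite /cv /=; ring.
exists (cvW t w1 w2); last by rewrite /= e1 e2.
exists t, w1, w2; split=> //.
- by case/andP: t01 => ? ?; rewrite !ltW.
(* Both ends are on the side of [p] for leaves not through [p]. A leaf through the non-vertex [p]
   coincides with [i] and contains both ends. *)
- move=> m; rewrite e1 e2; have [mp|mp] := eqVneq (l m p) 0.
    have km : k i = k m.
      apply: contrapT => kim; apply: nE; apply: (two_kinds_onE _ ip mp).
      by move: kim; case: (k i) (k m) => [] [].
    have [hu hv] := same_leaf_ends M km Dp nS ip mp.
    by rewrite !lf_cv mp hu hv !mulr0 addr0 mul0r.
  have h1 := c1 m; have h2 := c2 m.
  by have := mulr_ge0 h1 h2; rewrite mulrACA -expr2 pmulr_rge0 // exprn_even_gt0.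
by rewrite /= e1 e2 -pe.
Qed.

Hypothesis baseP : forall p, D2 p -> ~ onK p -> (exists2 w, G0 w & compat p w.1) ->
  G0 (base (sigma u v x s p)) /\ compat p (base (sigma u v x s p)).1.

(** If a leaf separated [p] strictly from [e], then [g] would not be strictly on the side of [p]
    either, and an inner point of the edge would be separated from [p]. *)
Lemma compat_end p e g t : ~ onK p -> 0 <= t <= 1 -> compat e g ->
  compat p (cv t e g) -> compat p e \/ compat p g.
Proof.
move=> nK /unit_cases[->|->|/andP[t0 t1]] eg; rewrite ?cv0 ?cv1; [by left|by right|].
move=> c; left=> i; have := eg i; have := c i; rewrite lf_cv.
have pn : l i p != 0 by apply/eqP => ip; apply: nK; right; exists i.
have p2 : 0 < l i p ^+ 2 by rewrite exprn_even_gt0.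
move=> h1 h2; rewrite leNgt; apply/negP => h3.
have h4 : 0 <= (l i p * l i e) * (l i p * l i g).
  by rewrite mulrACA -expr2 mulr_ge0 // ltW.
have h5 : l i p * l i g <= 0 by rewrite -(nmulr_rge0 _ h3).
have h6 : (1 - t) * (l i p * l i e) < 0 by rewrite pmulr_rlt0 // subr_gt0.
have h7 : t * (l i p * l i g) <= 0 by rewrite pmulr_rle0.
lra.
Qed.

(** A ray from [p] towards an arbitrarily chosen circle point ends on an edge, one end of which is
    compatible with [p]. *)
Lemma base_exists p : D2 p -> ~ onK p -> exists2 w, G0 w & compat p w.1.
Proof.
move=> Dp nK.
have S : S1 ((1, 0) : pt) by rewrite /S1 /= expr1n expr0n addr0.
have py : p <> (1, 0) by move=> e; apply: nK; left; rewrite e.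
have [t [t0 Db c Kb]] := ray_end_onK Dp nK py.
have [w [r [e [g [r01 [Ge Gg] eg -> _]]]] ew] := G1_total Db Kb.
rewrite -ew in c; case: (compat_end nK r01 eg c) => h.
  by exists e.
by exists g.
Qed.

Lemma G2_total p : D2 p -> exists2 w, G2 w & w.1 = p.
Proof.
move=> Dp; have [K|nK] := pselect (onK p).
  by have [w Gw wp] := G1_total Dp K; exists w => //; exact: G1_G2 D _ Gw.
have [] := baseP Dp nK (base_exists Dp nK).
set e := base _ => Ge ce.
have Ke : onK e.1 by exact: onE_onK (G0_onE D Ge).
have pe : p <> e.1 by move=> h; apply: nK; rewrite h.
(* The reflection of [e.1] in [p]: the ray leaves [p] directly away from the cone vertex, and its
   end [b] puts [p] between [e] and [b]. *)
have py : p <> cv 2 e.1 p.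
  move=> h; apply: pe; move: (f_equal fst h) (f_equal snd h); rewrite /cv /= => h1 h2.
  by apply: ptP; lra.
have [t [t0 Db c Kb]] := ray_end_onK Dp nK py.
have [b Gb eb] := G1_total Db Kb.
have t1 : 1 + t != 0 by rewrite gt_eqF // ltr_wpDr.
have ep : p = cv (1 + t)^-1 e.1 b.1.
  by rewrite eb; apply: ptP; rewrite /cv /=; field.
exists (cvW (1 + t)^-1 e b); last by rewrite /= -ep.
exists (1 + t)^-1, e, b; split=> //.
- by rewrite invr_ge0 invf_le1 ?addr_ge0 ?ler01 //= ?lerDl // ltr_wpDr.
(* Both [e] and [b] are weakly on the side of [p], where no leaf vanishes, hence on the same
   side. *)
- move=> i; have := mulr_ge0 (ce i) (c i); rewrite mulrACA -expr2 eb pmulr_rge0 //.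
  by rewrite exprn_even_gt0 //=; apply/eqP => ip; apply: nK; right; exists i.
by right; rewrite /= -ep.
Qed.

End Totality.

(** * The homeomorphism of the disc *)

Section GraphMap.
Variable R : realType.
Notation pt := (R * R)%type.
Implicit Types (C : set (pt * pt)) (p q : pt).

Definition graph_map C p : pt := (xget (p, p) [set w | C w /\ w.1 = p]).2.

Definition functional_graph C := forall w z, C w -> C z -> w.1 = z.1 -> w = z.

Lemma graph_mapP C p : (exists2 w, C w & w.1 = p) -> C (p, graph_map C p).
Proof.
move=> [w Cw wp]; rewrite /graph_map; case: xgetP => [[a b] _ [Cab /= <-] //|h].
by case: (h w).
Qed.

Lemma graph_map_eq C w : functional_graph C -> C w -> graph_map C w.1 = w.2.
Proof.
move=> fC Cw; have h : C (w.1, graph_map C w.1) by apply: graph_mapP; exists w.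
by rewrite -(fC _ _ h Cw erefl).
Qed.

(** The points that have an image outside an open set form the projection of a compact set, hence a
    closed set. *)
Lemma continuous_graph_map C A : compact C -> functional_graph C ->
  (forall p, A p -> exists2 w, C w & w.1 = p) -> {within A, continuous (graph_map C)}.
Proof.
move=> cC fC tC; apply/subspace_continuousP => p Ap N.
rewrite nbhsE => nN; case: nN => O [oO Op] ON.
pose B := fst @` (C `&` (snd @^-1` (~` O))).
have clB : closed B.
  apply: compact_closed; first exact: plane_hausdorff.
  apply: continuous_compact.
    by apply: continuous_subspaceT; exact: (continuous_fst (@continuous_id _)).
  apply: compact_closedI => //; apply: closed_preimage; last exact: open_closedC.
  exact: (continuous_snd (@continuous_id _)).
have nB : nbhs p (~` B).
  apply: open_nbhs_nbhs; split; first exact: closed_openC.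
  by move=> [w [Cw /= nO] wp]; apply: nO; rewrite -(graph_map_eq fC Cw) wp.
have : nbhs p [set q | A q -> N (graph_map C q)].
  apply: filterS nB => q nBq Aq; apply: ON; apply: contrapT => nO; apply: nBq.
  by exists (q, graph_map C q) => //; split=> //; apply: graph_mapP; exact: tC.
by [].
Qed.

End GraphMap.

(** * Choice of cone vertices and assembly *)

Section DiscHomeomorphism.
Variables (R : realType) (I J : Type) (u v : I -> J) (k : I -> bool).
Notation pt := (R * R)%type.

(** Stated through the pattern [sg] instead of a point of the region, so that one choice serves the
    whole region. *)
Definition base_ok (x x' : J -> pt) (s s' : I -> R) (sg : I -> bool) (w : pt * pt) :=
  G0 u v k x x' s s' w /\
  forall i, if sg i then 0 <= lf u v x s i w.1 else lf u v x s i w.1 <= 0.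

Lemma base_okP x x' s s' p w : ~ onK u v x s p ->
  base_ok x x' s s' (sigma u v x s p) w <-> G0 u v k x x' s s' w /\ compat u v x s p w.1.
Proof.
move=> nK; have nz i : lf u v x s i p <> 0 by move=> h; apply: nK; right; exists i.
have sgn i : 0 < lf u v x s i p \/ lf u v x s i p < 0.
  by have [|h|h] := ltgtP 0 (lf u v x s i p); [left|right|case: (nz i)].
split=> -[Gw h]; split=> // i; have := h i; rewrite /sigma; case: (sgn i) => pi.
- by rewrite pi => h'; rewrite mulr_ge0 // ltW.
- by rewrite (lt_gtF pi) => h'; rewrite mulr_le0 // ltW.
- by rewrite pi pmulr_rge0.
by rewrite (lt_gtF pi) nmulr_rge0.
Qed.

Lemma base_ok_sym x x' s s' sg w : dmodel u v k x x' s s' ->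
  base_ok x x' s s' sg w -> base_ok x' x s' s sg (swap_pair w).
Proof.
move=> D [Gw h]; split; first exact: G0_sym.
move=> i; have := h i; have := G0_agree D Gw i; rewrite /swap_pair /=.
by case: (sg i) => e; [rewrite -sgr_ge0 e sgr_ge0|rewrite -sgr_le0 e sgr_le0].
Qed.

Variables (x x' : J -> pt) (s s' : I -> R).
Hypothesis D : dmodel u v k x x' s s'.

Theorem model_homeo : exists F : pt -> pt, [/\ homeo_on (@D2 R) F,
  (forall j, F (x j) = x' j) &
  (forall i p, D2 p -> lf u v x s i p = 0 <-> lf u v x' s' i (F p) = 0)].
Proof.
pose base sg := xget ((0, 0), (0, 0)) [set w | base_ok x x' s s' sg w].
have base_spec sg w : base_ok x x' s s' sg w -> base_ok x x' s s' sg (base sg).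
  by move=> h; exact: (xgetPex _ (ex_intro _ w h)).
have tot p : D2 p -> exists2 w, G2 u v k x x' s s' base w & w.1 = p.
  apply: (G2_total D) => q _ nK [w Gw c]; apply/(base_okP _ _ _ nK).
  by apply: (base_spec _ w); apply/base_okP.
have D' := dmodel_sym D.
(* Not a new choice: the swapped vertices must be used for the inverse to come from the same
   graph. *)
pose base' := swap_pair \o base.
have tot' p : D2 p -> exists2 w, G2 u v k x' x s' s base' w & w.1 = p.
  apply: (G2_total D') => q _ nK [w Gw c]; apply/(base_okP _ _ _ nK).
  apply: (base_ok_sym D); apply: (base_spec _ (swap_pair w)).
  by rewrite -[w]swap_pairK; apply: (base_ok_sym D'); rewrite swap_pairK; apply/base_okP.
pose C := G2 u v k x x' s s' base; pose C' := G2 u v k x' x s' s base'.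
have sym w : C w -> C' (swap_pair w) by exact: (G2_sym D).
have sym' w : C' w -> C (swap_pair w).
  move=> h; have := G2_sym D' h; congr (G2 _ _ _ _ _ _ _ _ _).
  by apply/funext => sg; rewrite /base' /= swap_pairK.
have fC : functional_graph C by move=> w z; exact: (G2_fun D).
have fC' : functional_graph C' by move=> w z; exact: (G2_fun D').
have cpt (E : set (pt * pt)) : closed E -> (forall w, E w -> D2 w.1 /\ D2 w.2) -> compact E.
  move=> clE h; have c := compact_setX (@compact_D2 R) (@compact_D2 R).
  exact: subclosed_compact clE c h.
have DC w : C w -> D2 w.1 /\ D2 w.2.
  by move=> h; split; [exact: (G2_D2 D) h|exact: (G2_D2 D') (sym _ h)].
have DC' w : C' w -> D2 w.1 /\ D2 w.2.
  by move=> h; split; [exact: (G2_D2 D') h|exact: (G2_D2 D) (sym' _ h)].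
have cC : compact C by apply: cpt => //; exact: (G2_closed D).
have cC' : compact C' by apply: cpt => //; exact: (G2_closed D').
have gC p : D2 p -> C (p, graph_map C p) by move=> Dp; apply: graph_mapP; exact: tot.
have gC' p : D2 p -> C' (p, graph_map C' p) by move=> Dp; apply: graph_mapP; exact: tot'.
exists (graph_map C); split.
- exists (graph_map C'); split.
  + by move=> p /gC/DC[].
  + by move=> p /gC'/DC'[].
  + by move=> p /gC/sym/(graph_map_eq fC').
  + by move=> p /gC'/sym'/(graph_map_eq fC).
  by split; exact: continuous_graph_map.
- move=> j; have h : C (x j, x' j).
    by apply: (G1_G2 _ D); apply: (G0_G1 D); left; exists j.
  exact: (graph_map_eq fC h).
move=> i p Dp; have := G2_agree D (gC p Dp) i => /= e.
by split; [exact: sg_eq0 e|exact: sg_eq0 (esym e)].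
Qed.

End DiscHomeomorphism.

(** * Separation on the circle *)

Section Circle.
Variable R : realType.
Notation pt := (R * R)%type.
Implicit Types (a b c d w x y : pt).

(* Second intersection with the circle of the line through [a] directed by [w]. *)
Definition second_point a w : pt :=
  let r := - 2 * (a.1 * w.1 + a.2 * w.2) * (w.1 ^+ 2 + w.2 ^+ 2)^-1 in
  (a.1 + r * w.1, a.2 + r * w.2).

Lemma second_point_S1 a w : S1 a -> w.1 ^+ 2 + w.2 ^+ 2 != 0 -> S1 (second_point a w).
Proof.
rewrite /S1 /= => Sa w0.
transitivity (a.1 ^+ 2 + a.2 ^+ 2); last exact: Sa.
by field.
Qed.

Lemma second_point_det a b w :
  det a b (second_point a w) = - 2 * (a.1 * w.1 + a.2 * w.2) *
    (w.1 ^+ 2 + w.2 ^+ 2)^-1 * ((b.1 - a.1) * w.2 - (b.2 - a.2) * w.1).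
Proof. by rewrite /det /second_point /=; ring. Qed.

Lemma second_point_eq a c : S1 a -> S1 c -> a <> c ->
  second_point a (c.1 - a.1, c.2 - a.2) = c.
Proof.
rewrite /S1 /= => Sa Sc /dsq_gt0; rewrite /dsq => d0.
have n0 : (c.1 - a.1) ^+ 2 + (c.2 - a.2) ^+ 2 != 0.
  have -> : (c.1 - a.1) ^+ 2 + (c.2 - a.2) ^+ 2 = (a.1 - c.1) ^+ 2 + (a.2 - c.2) ^+ 2 by ring.
  by rewrite gt_eqF.
rewrite /second_point /=.
have -> : - 2 * (a.1 * (c.1 - a.1) + a.2 * (c.2 - a.2)) =
    (c.1 - a.1) ^+ 2 + (c.2 - a.2) ^+ 2 by lra.
by rewrite mulfV //; apply: ptP; rewrite /=; ring.
Qed.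

Lemma S1_dot a c : S1 a -> S1 c -> a <> c -> a.1 * c.1 + a.2 * c.2 < 1.
Proof. rewrite /S1 /= => Sa Sc /dsq_gt0; rewrite /dsq; lra. Qed.

(** Projecting the segment from [c] to [d] from [a] onto the circle gives a path that avoids [a] and
    [b]. *)
Lemma same_side_component a b c d : S1 a -> S1 b -> a <> b -> S1 c -> S1 d ->
  0 < det a b c * det a b d -> connected_component (@S1 R `\` [set a; b]) c d.
Proof.
move=> Sa Sb ab Sc Sd h.
have nab p : det a b p <> 0 -> ~ [set a; b] p.
  by move=> n [] /= e; apply: n; rewrite e ?det_cvl ?det_cvr.
have cn : det a b c <> 0 by move=> e; move: h; rewrite e mul0r ltxx.
have dn : det a b d <> 0 by move=> e; move: h; rewrite e mulr0 ltxx.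
have [<-|/eqP cd] := eqVneq c d.
  by apply: connected_component_refl; split=> //; exact: nab.
have ac : a <> c by move=> e; apply: (nab _ cn); left.
have ad : a <> d by move=> e; apply: (nab _ dn); left.
pose w t : pt := ((cv t c d).1 - a.1, (cv t c d).2 - a.2).
have w0 t : (w t).1 ^+ 2 + (w t).2 ^+ 2 != 0.
  have -> : (w t).1 ^+ 2 + (w t).2 ^+ 2 = dsq a (cv t c d) by rewrite /dsq /=; ring.
  apply/eqP => /dsq_eq0 e; have := det0_cv c d t; rewrite -e.
  by case/(S1_det0 Sc Sd cd Sa).
pose g t := second_point a (w t).
have cg : continuous g.
  have cw : continuous w by rewrite /w /cv; cts.
  have c1 := continuous_fst cw; have c2 := continuous_snd cw.
  have cn2 := continuous_add (continuous_sqr c1) (continuous_sqr c2).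
  have ci := continuous_inv w0 cn2.
  have ck (r : R) : continuous (fun _ : R => r) by move=> ?; exact: cvg_cst.
  have cr := continuous_mul (continuous_mul (ck (- 2)) (continuous_add
    (continuous_mul (ck a.1) c1) (continuous_mul (ck a.2) c2))) ci.
  exact: continuous_pair (continuous_add (ck a.1) (continuous_mul cr c1))
    (continuous_add (ck a.2) (continuous_mul cr c2)).
exists (g @` `[0, 1]); last first.
  by exists 1; rewrite /= ?in_itv /= ?ler01 ?lexx // /g /w cv1; exact: second_point_eq.
split.
- by exists 0; rewrite /= ?in_itv /= ?ler01 ?lexx // /g /w cv0; exact: second_point_eq.
- move=> _ [t + <-]; rewrite /= in_itv /= => /andP[t0 t1]; split.
    exact: second_point_S1.
  apply: nab; apply/eqP; rewrite /g second_point_det.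
  have hw : a.1 * (w t).1 + a.2 * (w t).2 < 0.
    have h1 := S1_dot Sa Sc ac; have h2 := S1_dot Sa Sd ad.
    have -> : a.1 * (w t).1 + a.2 * (w t).2 =
      (1 - t) * (a.1 * c.1 + a.2 * c.2) + t * (a.1 * d.1 + a.2 * d.2)
      - (a.1 ^+ 2 + a.2 ^+ 2) by rewrite /w /cv /=; ring.
    rewrite [a.1 ^+ 2 + _]Sa subr_lt0.
    have [->|tn0] := eqVneq t 0; first by rewrite subr0 mul1r mul0r addr0.
    have tp : 0 < t by rewrite lt_neqAle eq_sym tn0.
    have h3 : t * (a.1 * d.1 + a.2 * d.2) < t * 1 by rewrite ltr_pM2l.
    have h4 : (1 - t) * (a.1 * c.1 + a.2 * c.2) <= (1 - t) * 1.
      by rewrite ler_wpM2l ?subr_ge0 // ltW.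
    lra.
  have -> : (b.1 - a.1) * (w t).2 - (b.2 - a.2) * (w t).1 = det a b (cv t c d) by [].
  apply: mulf_neq0; first apply: mulf_neq0; first apply: mulf_neq0.
  - by rewrite oppr_eq0 pnatr_eq0.
  - by rewrite lt_eqF.
  - by rewrite invr_neq0.
  rewrite det_cv.
  apply/eqP => e; have : 0 < ((1 - t) * det a b c + t * det a b d) * det a b c.
    have : 0 < det a b c ^+ 2 by rewrite exprn_even_gt0 //=; apply/eqP.
    nra.
  by rewrite e mul0r ltxx.
apply: connected_continuous_connected; first exact: segment_connected.
exact: continuous_subspaceT.
Qed.

(** Intermediate values: on a connected set, [det a b] cannot change sign without meeting [a] or
    [b]. *)
Lemma component_same_side a b c d : S1 a -> S1 b -> a <> b ->
  connected_component (@S1 R `\` [set a; b]) c d -> 0 < det a b c * det a b d.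
Proof.
move=> Sa Sb ab [B [Bc BA cB] Bd]; rewrite ltNge; apply/negP => h.
have cdet : continuous (det a b) by rewrite /det; cts.
have /connected_intervalP iv : connected (det a b @` B).
  by apply: connected_continuous_connected => //; exact: continuous_subspaceT.
have [e Be e0] : (det a b @` B) 0.
  have hc : (det a b @` B) (det a b c) by exists c.
  have hd : (det a b @` B) (det a b d) by exists d.
  have [c0|c0] := leP (det a b c) 0.
    have [d0|d0] := leP 0 (det a b d); first by apply: (iv _ _ hc hd); rewrite c0 d0.
    apply: (iv _ _ hc hc); rewrite c0 /=; nra.
  have d0 : det a b d <= 0 by nra.
  by apply: (iv _ _ hd hc); rewrite d0 ltW.
have [Se] := BA e Be; apply.
by case: (S1_det0 Sa Sb ab Se e0) => ->; [left|right].
Qed.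

Lemma det_neq0_S1 a b c : S1 a -> S1 b -> a <> b -> S1 c ->
  (det a b c <> 0) <-> (@S1 R `\` [set a; b]) c.
Proof.
move=> Sa Sb ab Sc; split.
  by move=> n; split=> // -[] /= e; apply: n; rewrite e ?det_cvl ?det_cvr.
move=> [_ n] e; apply: n.
by case: (S1_det0 Sa Sb ab Sc e) => ->; [left|right].
Qed.

Lemma point_on_side x y : S1 x -> S1 y -> x <> y -> exists2 c, S1 c & 0 < det x y c.
Proof.
move=> Sx Sy xy; have e0 := dsq_gt0 xy; have h := S1_dot Sx Sy xy.
pose X := 1 - (x.1 * y.1 + x.2 * y.2).
pose Y := - x.1 * (y.2 - x.2) + x.2 * (y.1 - x.1).
(* The direction [w] is [m] times [y - x] plus [y - x] turned by a right angle. This [m] gives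
   scalar product [- (m * X) + Y <= -1] with [x], so the line enters the disc, and the turned part
   fixes the side. *)
pose m := (`|Y| + 1) / X.
have X0 : 0 < X by rewrite /X; lra.
have m0 : 0 < m by rewrite divr_gt0 // ltr_wpDl.
pose w : pt := (m * (y.1 - x.1) - (y.2 - x.2), m * (y.2 - x.2) + (y.1 - x.1)).
have xw : x.1 * w.1 + x.2 * w.2 < 0.
  have -> : x.1 * w.1 + x.2 * w.2 = m * (x.1 * y.1 + x.2 * y.2 - (x.1 ^+ 2 + x.2 ^+ 2)) + Y.
    by rewrite /w /Y /=; ring.
  rewrite [x.1 ^+ 2 + _]Sx.
  have -> : m * (x.1 * y.1 + x.2 * y.2 - 1) = - (m * X) by rewrite /X; ring.
  rewrite /m divfK ?gt_eqF //; have := ler_norm Y; lra.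
have ww : w.1 ^+ 2 + w.2 ^+ 2 = (m ^+ 2 + 1) * dsq x y by rewrite /w /dsq /=; ring.
have w0 : 0 < w.1 ^+ 2 + w.2 ^+ 2 by rewrite ww mulr_gt0 // ltr_wpDl ?sqr_ge0.
exists (second_point x w); first by apply: second_point_S1 => //; rewrite gt_eqF.
rewrite second_point_det.
have -> : (y.1 - x.1) * w.2 - (y.2 - x.2) * w.1 = dsq x y by rewrite /w /dsq /=; ring.
apply: mulr_gt0 => //; apply: mulr_gt0; last by rewrite invr_gt0.
by rewrite nmulr_rgt0 // oppr_lt0.
Qed.

(** * Homeomorphisms of the circle preserve separation *)

Section Homeo.
Variable f : pt -> pt.
Hypothesis hf : homeo_on (@S1 R) f.

Lemma homeo_S1 a : S1 a -> S1 (f a).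
Proof. by case: hf => g [h _ _ _ _]; exact: h. Qed.

Lemma homeo_inj a b : S1 a -> S1 b -> f a = f b -> a = b.
Proof.
by case: hf => g [_ _ gf _ _] Sa Sb e; rewrite -(gf _ Sa) e gf.
Qed.

Lemma homeo_same_side a b c d : S1 a -> S1 b -> a <> b -> S1 c -> S1 d ->
  0 < det a b c * det a b d -> 0 < det (f a) (f b) (f c) * det (f a) (f b) (f d).
Proof.
move=> Sa Sb ab Sc Sd /(same_side_component Sa Sb ab Sc Sd)[B [Bc BA cB] Bd].
apply: component_same_side; [exact: homeo_S1|exact: homeo_S1| |].
  by move=> e; apply: ab; exact: homeo_inj e.
exists (f @` B); last by exists d.
split; first by exists c.
  move=> _ [e Be <-]; have [Se ne] := BA e Be; split; first exact: homeo_S1.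
  by case=> /= /homeo_inj h; apply: ne; [left|right]; exact: h.
apply: connected_continuous_connected => //.
apply: (@continuous_subspaceW _ _ B (@S1 R)); first by move=> e /BA[].
by case: hf => g [_ _ _ _ []].
Qed.

End Homeo.

Lemma homeo_same_sideE f a b c d : homeo_on (@S1 R) f ->
  S1 a -> S1 b -> a <> b -> S1 c -> S1 d ->
  0 < det a b c * det a b d <-> 0 < det (f a) (f b) (f c) * det (f a) (f b) (f d).
Proof.
move=> hf Sa Sb ab Sc Sd; split; first exact: homeo_same_side.
case: (hf) => g [h1 h2 gf fg [cf cg]].
have hg : homeo_on (@S1 R) g by exists f; split.
have fab : f a <> f b by move=> e; apply: ab; exact: (homeo_inj hf) e.
have S e : S1 e -> S1 (f e) by exact: h1.
move/(homeo_same_side hg (S _ Sa) (S _ Sb) fab (S _ Sc) (S _ Sd)).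
by rewrite !gf.
Qed.

(* [f] may reverse the orientation. *)
Lemma homeo_orientation f a b : homeo_on (@S1 R) f -> S1 a -> S1 b -> a <> b ->
  exists2 e : R, e != 0 &
    forall c, S1 c -> Num.sg (det a b c) = Num.sg (e * det (f a) (f b) (f c)).
Proof.
move=> hf Sa Sb ab.
have Sf c : S1 c -> S1 (f c) by exact: homeo_S1.
have fab : f a <> f b by move=> e; apply: ab; exact: (homeo_inj hf) e.
pose d := det a b; pose d' c := det (f a) (f b) (f c).
have z c : S1 c -> d c = 0 -> d' c = 0.
  by move=> Sc /(S1_det0 Sa Sb ab Sc)[] ->; rewrite /d' ?det_cvl ?det_cvr.
have z' c : S1 c -> d' c = 0 -> d c = 0.
  move=> Sc /(S1_det0 (Sf _ Sa) (Sf _ Sb) fab (Sf _ Sc))[] /(homeo_inj hf) -> //;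
    by rewrite /d ?det_cvl ?det_cvr.
(* One point whose side is reversed forces reversal everywhere, by comparison with it; otherwise
   nothing is reversed. *)
have [[c0 [S0 h0]]|no] := pselect (exists c, S1 c /\ d c * d' c < 0).
  exists (- 1); first by rewrite oppr_eq0 oner_eq0.
  move=> c Sc; rewrite mulN1r sgrN -/(d c) -/(d' c).
  have [dc|dc] := eqVneq (d c) 0; first by rewrite dc (z _ Sc dc) sgr0 oppr0.
  have dc' : d' c != 0 by apply: contra_neq dc; exact: z'.
  have n0 : d c0 != 0 by apply/eqP => e; move: h0; rewrite e mul0r ltxx.
  have n0' : d' c0 != 0 by apply/eqP => e; move: h0; rewrite e mulr0 ltxx.
  have E := homeo_same_sideE hf Sa Sb ab Sc S0.
  rewrite -/(d c) -/(d c0) -/(d' c) -/(d' c0) in E.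
  have pp : 0 < (d c * d c0) * (d' c * d' c0).
    have [p|p] := ltP 0 (d c * d c0); first by rewrite mulr_gt0 // -E.
    have {}p : d c * d c0 < 0 by rewrite lt_neqAle p andbT mulf_neq0.
    rewrite nmulr_rgt0 // lt_neqAle mulf_neq0 //= leNgt; apply/negP => /E q.
    by move: (lt_trans p q); rewrite ltxx.
  rewrite mulrACA nmulr_lgt0 // in pp.
  have [p|p|e] := ltgtP 0 (d c); last by rewrite -e eqxx in dc.
    by rewrite gtr0_sg // ltr0_sg ?opprK //; rewrite pmulr_rlt0 in pp.
  by rewrite ltr0_sg // gtr0_sg //; rewrite nmulr_rlt0 in pp.
exists 1; first exact: oner_neq0.
move=> c Sc; rewrite mul1r -/(d c) -/(d' c).
have [dc|dc] := eqVneq (d c) 0; first by rewrite dc (z _ Sc dc).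
have dc' : d' c != 0 by apply: contra_neq dc; exact: z'.
have pp : 0 < d c * d' c.
  rewrite lt_neqAle eq_sym mulf_neq0 //= leNgt; apply/negP => h.
  by apply: no; exists c.
have [p|p|e] := ltgtP 0 (d c); last by rewrite -e eqxx in dc.
  by rewrite !gtr0_sg //; rewrite pmulr_rgt0 in pp.
by rewrite !ltr0_sg //; rewrite nmulr_rgt0 in pp.
Qed.

End Circle.

(** * Fully transverse laminations *)

Section Laminations.
Variable R : realType.
Notation pt := (R * R)%type.
Implicit Types (L : set (set pt)) (l m : set pt) (x y : pt) (z : pt * pt).

(** Ordered pairs give leaves a topology in which limits can be taken; each leaf appears in both
    orders. *)
Definition leaf_pairs L : set (pt * pt) :=
  [set z | [/\ S1 z.1, S1 z.2, z.1 <> z.2 & L [set z.1; z.2]]].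

Definition limit_leaf L z :=
  [/\ S1 z.1, S1 z.2, z.1 <> z.2 & closure (leaf_pairs L) z].

Lemma leaf_pair L l : (forall l, L l -> is_pair l) -> L l ->
  exists2 z, leaf_pairs L z & l = [set z.1; z.2].
Proof.
move=> h Ll; have [a [b [Sa Sb /eqP ab e]]] := h _ Ll.
by exists (a, b) => //; split=> //=; rewrite -e.
Qed.

Lemma cross_det b1 b2 l : S1 b1 -> S1 b2 -> b1 <> b2 -> cross l [set b1; b2] ->
  exists a1 a2, [/\ l = [set a1; a2], S1 a1, S1 a2 & det b1 b2 a1 * det b1 b2 a2 < 0].
Proof.
move=> S1b S2b b12 [a1 [a2 [-> A1 A2 n]]].
have S1a : S1 a1 by case: A1. have S2a : S1 a2 by case: A2.
exists a1, a2; split=> //; rewrite ltNge; apply/negP => h; apply: n.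
apply: same_side_component => //; rewrite lt_neqAle h andbT eq_sym.
by apply: mulf_neq0; apply/eqP/(det_neq0_S1 S1b S2b b12).
Qed.

Lemma det_cross z z' : S1 z.1 -> S1 z.2 -> S1 z'.1 -> S1 z'.2 -> z'.1 <> z'.2 ->
  det z'.1 z'.2 z.1 * det z'.1 z'.2 z.2 < 0 -> cross [set z.1; z.2] [set z'.1; z'.2].
Proof.
move=> Sz1 Sz2 Sz1' Sz2' ne h; exists z.1, z.2; split=> //.
- apply/(det_neq0_S1 Sz1' Sz2' ne) => // e.
  by move: h; rewrite e mul0r ltxx.
- apply/(det_neq0_S1 Sz1' Sz2' ne) => // e.
  by move: h; rewrite e mulr0 ltxx.
move/(component_same_side Sz1' Sz2' ne) => p.
by move: (lt_trans p h); rewrite ltxx.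
Qed.

Lemma noncross_pairs L z z' : prelamination L -> leaf_pairs L z -> leaf_pairs L z' ->
  0 <= det z'.1 z'.2 z.1 * det z'.1 z'.2 z.2.
Proof.
move=> [_ nc] [Sz1 Sz2 _ Lz] [Sz1' Sz2' ne Lz']; rewrite leNgt; apply/negP => h.
by apply: nc Lz Lz' _; exact: det_cross.
Qed.

(** Weak non-crossing is a closed condition in each pair; the limits are taken one at a time. *)
Lemma noncross_limits L z z' : prelamination L -> limit_leaf L z -> limit_leaf L z' ->
  0 <= det z'.1 z'.2 z.1 * det z'.1 z'.2 z.2.
Proof.
move=> pL [_ _ _ cz] [_ _ _ cz'].
have step1 (y : pt * pt) : leaf_pairs L y -> 0 <= det y.1 y.2 z.1 * det y.1 y.2 z.2.
  move=> Ly; have c : closed [set t : pt * pt | 0 <= det y.1 y.2 t.1 * det y.1 y.2 t.2].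
    by apply: closed_ge0; rewrite /det; cts.
  by apply: c; apply: (closureS _ cz) => t Lt; exact: (noncross_pairs pL Lt Ly).
have c : closed [set t : pt * pt | 0 <= det t.1 t.2 z.1 * det t.1 t.2 z.2].
  by apply: closed_ge0; rewrite /det; cts.
by apply: c; apply: (closureS _ cz') => t; exact: step1.
Qed.

Lemma cross_chain_l L l m : cross_chain L l m -> L l.
Proof. by case. Qed.

(** A leaf with an end strictly on the positive side and not crossing [xy] is positive in its
    interior, in particular where it meets the next leaf. That leaf then has a positive end too. *)
Lemma chain_side L x y l m : S1 x -> S1 y -> x <> y ->
  (forall l, L l -> is_pair l) ->
  (forall z, leaf_pairs L z -> 0 <= det x y z.1 * det x y z.2) ->
  cross_chain L l m ->
  (exists2 c, l c & 0 < det x y c) -> exists2 c, m c & 0 < det x y c.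
Proof.
move=> Sx Sy xy pL nx; elim=> // {}l l' {}m Ll cr ch IH [c lc pc]; apply: IH.
have [z [Sz1 Sz2 ne Lz] el'] := leaf_pair pL (cross_chain_l ch).
rewrite el' in cr *; have [a1 [a2 [el S1a S2a h]]] := cross_det Sz1 Sz2 ne cr.
have a12 : a1 <> a2.
  by move=> e; move: h; rewrite e ltNge -expr2 sqr_ge0.
have [t t01 et] := sign_change_cv h.
have Dp : D2 (cv t a1 a2) by apply: D2_cv; [lra|exact: S1_D2|exact: S1_D2].
have nSp : ~ S1 (cv t a1 a2).
  by move=> /(S1_cv t01 (S1_D2 S1a) (S1_D2 S2a)).
have dp : det z.1 z.2 (cv t a1 a2) = 0 by rewrite det_cv.
have [r r01 er] := chord_param_lt Sz1 Sz2 ne Dp nSp dp.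
have na : 0 <= det x y a1 * det x y a2.
  by apply: (nx (a1, a2)); split=> //=; rewrite -el.
have pp : 0 < det x y (cv t a1 a2).
  rewrite det_cv; move: lc; rewrite el => -[] /= ec; rewrite ec in pc.
    by rewrite pmulr_rge0 // in na; nra.
  by rewrite pmulr_lge0 // in na; nra.
apply: contrapT => no.
have nz1 : det x y z.1 <= 0.
  by rewrite leNgt; apply/negP => p; apply: no; exists z.1 => //; left.
have nz2 : det x y z.2 <= 0.
  by rewrite leNgt; apply/negP => p; apply: no; exists z.2 => //; right.
by move: pp; rewrite er det_cv; nra.
Qed.

(** By density some leaves have ends strictly on either side of [xy]. If no leaf crossed [xy], a
    chain between them would bring a positive end to a leaf with a negative one, which would
    cross. *)
Lemma crossed_by_leaf Lp Lm x y : fully_transverse Lp Lm -> S1 x -> S1 y -> x <> y ->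
  exists2 z, leaf_pairs (Lp `|` Lm) z & det z.1 z.2 x * det z.1 z.2 y < 0.
Proof.
move=> [[pairp _] [pairm _] _ dense chain] Sx Sy xy; apply: contrapT => no.
have pair l : (Lp `|` Lm) l -> is_pair l by case; [exact: pairp|exact: pairm].
have nx z : leaf_pairs (Lp `|` Lm) z -> 0 <= det x y z.1 * det x y z.2.
  move=> Lz; rewrite leNgt; apply/negP => h; apply: no; exists z => //.
  by case: Lz => Sz1 Sz2 ne _; apply: cross_sym.
have side a b : S1 a -> S1 b -> a <> b ->
    exists l, (Lp `|` Lm) l /\ exists2 c, l c & 0 < det a b c.
  move=> Sa Sb ab; have [c Sc pc] := point_on_side Sa Sb ab.
  have nc : nbhs c [set p | 0 < det a b p].
    by apply: open_nbhs_nbhs; split=> //; apply: open_gt0; rewrite /det; cts.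
  by have [e [[l Ll le] pe]] := dense c Sc _ nc; exists l; split=> //; exists e.
have [l [Ll hl]] := side _ _ Sx Sy xy.
have [m [Lm' [c mc hc]]] := side _ _ Sy Sx (nesym xy).
have [d md hd] := chain_side Sx Sy xy pair nx (chain _ _ Ll Lm') hl.
have hc' : det x y c < 0.
  have -> : det x y c = - det y x c by rewrite /det; ring.
  by rewrite oppr_lt0.
have [z Lz em] := leaf_pair pair Lm'; have := nx _ Lz.
rewrite em in mc md; case: mc md => /= ec [] /= ed; rewrite ec ed in hc' hd;
  rewrite leNgt => /negP; apply; nra.
Qed.

(** This form makes a geodesic the zero set of a side function, which is what the disc map
    preserves. *)
Lemma chord_det (a b : pt) : S1 a -> S1 b -> a <> b ->
  chord [set a; b] = [set p | D2 p /\ det a b p = 0].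
Proof.
move=> Sa Sb ab; apply/seteqP; split=> p.
  move=> [c [d [t [e t01 ->]]]].
  have onab q : [set a; b] q -> S1 q /\ det a b q = 0.
    by case=> /= ->; rewrite ?det_cvl ?det_cvr.
  have [Sc dc] : S1 c /\ det a b c = 0 by apply: onab; rewrite e; left.
  have [Sd dd] : S1 d /\ det a b d = 0 by apply: onab; rewrite e; right.
  by split; [apply: (D2_cv t01); exact: S1_D2|rewrite -/(cv t c d) det_cv dc dd !mulr0 addr0].
by case=> Dp /(chord_param Sa Sb ab Dp)[t t01 ->]; exists a, b, t.
Qed.

Variables (Lp Lm : set (set pt)) (f : pt -> pt).
Hypothesis ft : fully_transverse Lp Lm.
Hypothesis hf : homeo_on (@S1 R) f.

Definition lam (b : bool) := if b then Lp else Lm.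

Lemma lam_prelamination b : prelamination (lam b).
Proof. by case: ft => ? ? _ _ _; case: b. Qed.

(** The tag records the lamination of which the pair is a limit; it becomes the kind of the leaf. *)
Definition leaf_index := {q : bool * (pt * pt) | limit_leaf (lam q.1) q.2}.
Definition circle_index := {p : pt | S1 p}.

Definition leaf_kind (i : leaf_index) : bool := (sval i).1.

Lemma leaf_index_S1 (i : leaf_index) : S1 (sval i).2.1 /\ S1 (sval i).2.2.
Proof. by case: i => q []. Qed.

Definition leaf_u (i : leaf_index) : circle_index :=
  exist _ (sval i).2.1 (proj1 (leaf_index_S1 i)).
Definition leaf_v (i : leaf_index) : circle_index :=
  exist _ (sval i).2.2 (proj2 (leaf_index_S1 i)).

Lemma circle_index_inj (j j' : circle_index) : sval j = sval j' -> j = j'.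
Proof.
case: j j' => [p Sp] [q Sq] /= e; move: Sp Sq; rewrite e => Sp Sq.
by congr exist; exact: Prop_irrelevance.
Qed.

Lemma leaf_uv (i : leaf_index) : leaf_u i <> leaf_v i.
Proof. by move=> /(f_equal sval) /=; case: i => q []. Qed.

Definition dom_pos (j : circle_index) : pt := sval j.
Definition cod_pos (j : circle_index) : pt := f (sval j).

Lemma limit_leaf_pair b z : leaf_pairs (lam b) z -> limit_leaf (lam b) z.
Proof. by move=> h; case: (h) => *; split=> //; exact: subset_closure. Qed.

Lemma domain_model : model leaf_u leaf_v leaf_kind dom_pos (fun=> 1).
Proof.
split.
- by case.
- exact: circle_index_inj.
- by move=> p Sp; exists (exist _ p Sp).
- by move=> i; exact: oner_neq0.
- exact: leaf_uv.
- move=> i m; rewrite /lf !mul1r; case: i m => [[b z] hz] [[b' z'] hz'] /= e.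
  rewrite /leaf_kind /= in e; subst b'.
  exact: noncross_limits (lam_prelamination b) hz hz'.
move=> [p Sp] [q Sq] ne.
have pq : p <> q by move=> e; apply: ne; exact: circle_index_inj.
have [z [Sz1 Sz2 nz Lz] h] := crossed_by_leaf ft Sp Sq pq.
have [b Lb] : exists b, limit_leaf (lam b) z.
  by case: Lz => Lz; [exists true|exists false]; exact: limit_leaf_pair.
by exists (exist _ (b, z) Lb); rewrite /lf !mul1r.
Qed.

Lemma leaf_orientation : {e : leaf_index -> R & forall i, e i != 0 /\
  forall c, S1 c -> Num.sg (det (dom_pos (leaf_u i)) (dom_pos (leaf_v i)) c) =
    Num.sg (e i * det (cod_pos (leaf_u i)) (cod_pos (leaf_v i)) (f c))}.
Proof.
apply: (@choice _ _ (fun i e => e != 0 /\ forall c, S1 c ->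
  Num.sg (det (dom_pos (leaf_u i)) (dom_pos (leaf_v i)) c) =
    Num.sg (e * det (cod_pos (leaf_u i)) (cod_pos (leaf_v i)) (f c)))) => i.
case: i => [[b z] [Sz1 Sz2 ne c]].
by have [e e0 h] := homeo_orientation hf Sz1 Sz2 ne; exists e.
Qed.

(** Leaves may shrink to a point; adding the diagonal keeps all limits. *)
Definition closed_leaves b : set (pt * pt) :=
  (@S1 R `*` @S1 R) `&` (closure (leaf_pairs (lam b)) `|` [set z | dsq z.1 z.2 = 0]).

Lemma closed_leaves_compact b : compact (closed_leaves b).
Proof.
apply: compact_closedI; first by have := compact_setX (@compact_S1 R) (@compact_S1 R).
apply: closedU; first exact: closed_closure.
by apply: closed_eq0; rewrite /dsq; cts.
Qed.

Lemma continuous_on_pairs (A : set (pt * pt)) : A `<=` @S1 R `*` @S1 R ->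
  {within A, continuous (fun z => ((z.1, f z.1), (z.2, f z.2)))}.
Proof.
move=> AS; case: hf => g [_ _ _ _ [/subspace_continuousP cf _]].
apply/subspace_continuousP => z Az; have [Sz1 Sz2] := AS z Az.
have lim (pr : pt * pt -> pt) : continuous pr -> (forall w, A w -> S1 (pr w)) ->
    (fun w => f (pr w)) @ within A (nbhs z) --> f (pr z).
  move=> cpr Spr N nN; have /= h := cf _ (Spr _ Az) N nN.
  have : nbhs z (pr @^-1` [set p | S1 p -> N (f p)]) by exact: cpr.
  by apply: filterS => w /= Nw Aw; apply: Nw; exact: Spr.
have idl (pr : pt * pt -> pt) : continuous pr -> pr @ within A (nbhs z) --> pr z.
  move=> cpr N nN; have h : nbhs z (pr @^-1` N) by exact: cpr.
  by apply: filterS h => w /= Nw _.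
have c1 := continuous_fst (@continuous_id (pt * pt)%type).
have c2 := continuous_snd (@continuous_id (pt * pt)%type).
have two (pr : pt * pt -> pt) : continuous pr -> (forall w, A w -> S1 (pr w)) ->
    (fun w => (pr w, f (pr w))) @ within A (nbhs z) --> (pr z, f (pr z)).
  move=> cpr Spr; apply: (@cvg_pair _ _ _ _ (nbhs (pr z)) (nbhs (f (pr z)))).
    exact: idl.
  exact: lim.
apply: (@cvg_pair _ _ _ _ (nbhs (z.1, f z.1)) (nbhs (z.2, f z.2))).
  by apply: (two fst) => // w /AS[].
by apply: (two snd) => // w /AS[].
Qed.

Lemma Lam_compact b : compact (Lam leaf_u leaf_v leaf_kind dom_pos cod_pos b).
Proof.
have -> : Lam leaf_u leaf_v leaf_kind dom_pos cod_pos b =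
    (fun z => ((z.1, f z.1), (z.2, f z.2))) @` closed_leaves b.
  apply/seteqP; split=> w.
    case=> [[i ki ->]|[j ->]].
      exists (sval i).2 => //; move: ki; case: i => [[b' z] [Sz1 Sz2 ne c]] /= <-.
      by split=> //; left.
    exists (sval j, sval j) => //; case: j => p Sp /=.
    by split=> //; right; rewrite /= /dsq !subrr expr0n /= addr0.
  move=> [z [[Sz1 Sz2] h] <-].
  have [e|ne] := pselect (z.1 = z.2).
    by right; exists (exist _ z.1 Sz1); rewrite -e.
  case: h => [c|/dsq_eq0//].
  have lz : limit_leaf (lam b) z by [].
  by left; exists (exist _ (b, z) lz).
apply: continuous_compact; last by have := @closed_leaves_compact b.
by apply: continuous_on_pairs => z [].
Qed.

(** The crossing properties of the images are read off from the domain through equality of signs. *)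
Lemma lam_dmodel : exists s',
  dmodel leaf_u leaf_v leaf_kind dom_pos cod_pos (fun=> 1) s'.
Proof.
have M := domain_model; have [s' hs'] := leaf_orientation.
have sg i j : Num.sg (lf leaf_u leaf_v dom_pos (fun=> 1) i (dom_pos j)) =
    Num.sg (lf leaf_u leaf_v cod_pos s' i (cod_pos j)).
  by rewrite /lf mul1r; apply: (hs' i).2; case: j.
exists s'; split=> //; last by move=> b; exact: Lam_compact.
case: (hf) => g [fS gS gf fg _]; split.
- by case=> p Sp; exact: fS.
- move=> j j' /(homeo_inj hf) h; apply: circle_index_inj; apply: h; last by case: j'.
  by case: j.
- by move=> p Sp; exists (exist _ (g p) (gS _ Sp)); exact: fg.
- by move=> i; exact: (hs' i).1.
- exact: leaf_uv.
- by move=> i m e; apply: sg_le0 (sg m _) (sg m _) _; exact: model_noncross M _ _ e.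
move=> j j' /(model_cross M)[i h]; exists i; move: h.
by rewrite -sgr_lt0 sgrM !sg -sgrM sgr_lt0.
Qed.

Lemma lamination_homeo : exists F : pt -> pt,
  [/\ homeo_on (@D2 R) F, (forall x, S1 x -> F x = f x) &
      forall b g, Geo (lam b) g -> Geo (image_lam f (lam b)) (F @` g)].
Proof.
have [s' D] := lam_dmodel; have [F [hF Fj Fl]] := model_homeo D.
have FS p : S1 p -> F p = f p by move=> Sp; exact: (Fj (exist _ p Sp)).
exists F; split=> // b _ [l Ll <-].
have [pairs _] := lam_prelamination b.
have [z Lz el] := leaf_pair pairs Ll; case: (Lz) => Sz1 Sz2 ne _.
pose i : leaf_index := exist _ (b, z) (limit_leaf_pair Lz).
exists (f @` l); first by exists l.
have fz : f @` l = [set f z.1; f z.2].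
  by rewrite el image_setU !image_set1.
have fS p : S1 p -> S1 (f p) by exact: homeo_S1.
have fne : f z.1 <> f z.2 by move=> e; apply: ne; exact: (homeo_inj hf) e.
rewrite fz el (chord_det (fS _ Sz1) (fS _ Sz2) fne) (chord_det Sz1 Sz2 ne).
have Fdet p : D2 p -> det z.1 z.2 p = 0 <-> det (f z.1) (f z.2) (F p) = 0.
  move=> Dp; have := Fl i p Dp.
  have e0 := model_unit (dmodel_r D) i.
  rewrite /lf mul1r /= => h; rewrite h; split=> [/eqP|->]; last by rewrite mulr0.
  by rewrite mulf_eq0 (negPf e0) /= => /eqP.
case: hF => G [FD GD GF FG _]; apply/seteqP; split=> p /=.
  move=> [Dp dp]; exists (G p); last exact: FG.
  by split; [exact: GD|apply/Fdet; [exact: GD|rewrite FG]].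
by move=> [q [Dq dq] <-]; split; [exact: FD|apply/Fdet].
Qed.

End Laminations.

Theorem theoremA1 (R : realType) (Lp Lm : set (set (R * R)%type))
  (f : (R * R)%type -> (R * R)%type) :
  fully_transverse Lp Lm -> homeo_on (@S1 R) f ->
  exists F : (R * R)%type -> (R * R)%type,
    [/\ homeo_on (@D2 R) F,
        (forall x, S1 x -> F x = f x),
        (forall g, Geo Lp g -> Geo (image_lam f Lp) (F @` g)) &
        (forall g, Geo Lm g -> Geo (image_lam f Lm) (F @` g))].
Proof.
move=> ft hf; have [F [hF FS Fg]] := lamination_homeo ft hf.
by exists F; split=> //; [exact: (Fg true)|exact: (Fg false)].
Qed.
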